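(* Assume that $\sup_{t}V''(t)\le 1$ and $\liminf_{|t|\uparrow\infty}\frac{\log V(t)}{\log|t|}>1$, and let the $\eta_i$ be symmetrically distributed, i.i.d. with finite second moment. Let $d=2$. Then there is a constant $a>0$, independent of the distribution of the random fields $\eta_i$ and of the pinning strength $\varepsilon\ge 0$, such that $$\liminf_{L\uparrow\infty}\frac{1}{L^2\log L}\sum_{i\in\Lambda_L}\mathbb{E}\Bigl(\eta_i\,\mu_{\varepsilon,\Lambda_L}[\eta](\phi_i)\Bigr)\ \ge\ a\,\mathbb{E}(\eta_0^2).$$
   Context: $V:\mathbb{R}\to\mathbb{R}$ is a pair potential. For a finite set $\Lambda\subset\mathbb{Z}^d$, $\varepsilon\ge 0$, and a fixed configuration $\eta=(\eta_i)_{i\in\mathbb{Z}^d}$ of real external fields, $\mu_{\varepsilon,\Lambda}[\eta]$ is the quenched finite-volume Gibbs measure with zero boundary condition, i.e. the probability measure for the variables $\phi_\Lambda=(\phi_i)_{i\in\Lambda}\in\mathbb{R}^\Lambda$ given by $$\mu_{\varepsilon,\Lambda}[\eta](d\phi_\Lambda)=\frac{1}{Z_{\varepsilon,\Lambda}[\eta]}\exp\Bigl(-\frac1{4d}\sum_{\langle i,j\rangle\in\Lambda}V(\phi_i-\phi_j)-\frac1{4d}\sum_{i\in\Lambda,\,j\in\Lambda^c,\,|i-j|=1}V(\phi_i)+\sum_{i\in\Lambda}\eta_i\phi_i\Bigr)\prod_{i\in\Lambda}\bigl(d\phi_i+\varepsilon\,\delta_0(d\phi_i)\bigr),$$ where the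 first sum runs over nearest-neighbor pairs in $\Lambda$, $\Lambda^c=\mathbb{Z}^d\setminus\Lambda$, $d\phi_i$ is Lebesgue measure, $\delta_0$ is the Dirac measure at $0$, and $Z_{\varepsilon,\Lambda}[\eta]$ is the normalizing constant (partition function). $\mu_{\varepsilon,\Lambda}[\eta](f)$ denotes the expectation of $f$ under this measure. $\Lambda_L$ is the square of sidelength $2L+1$ in $\mathbb{Z}^2$ centered at the origin. $\mathbb{E}$ is the expectation over the random fields $\eta$.
   Formalization: The displayed inequality is proved when each expectation E(η_i μ(φ_i)) exists in [-∞,+∞], which a finite second moment alone does not guarantee; without that proviso, the same bound is proved with the expectation of the sum in place of the sum of expectations. *)

(* Defs.v *)
From HB Require Import structures.
From mathcomp Require Import all_boot all_order all_algebra.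
From mathcomp Require Import finmap.
From mathcomp Require Import all_classical all_reals all_analysis.

Set Implicit Arguments.
Unset Strict Implicit.
Unset Printing Implicit Defensive.

Import Order.TTheory GRing.Theory Num.Theory.
Import numFieldNormedType.Exports.

Local Open Scope classical_set_scope.
Local Open Scope ring_scope.

Definition abs_pinfty (R : realType) : set_system R :=
  filter_from [set: R] (fun M : R => [set t | M < `|t|]).
Arguments abs_pinfty R : clear implicits.

Definition site (d : nat) := 'rV[int]_d.

Definition up_neighbours d (i : site d) : seq (site d) :=
  [seq i + delta_mx 0 k | k : 'I_d].

Definition down_neighbours d (i : site d) : seq (site d) :=
  [seq i - delta_mx 0 k | k : 'I_d].

(* The 2d sites at distance 1 from i, without repetition. *)
Definition neighbours d (i : site d) : seq (site d) :=
  up_neighbours i ++ down_neighbours i.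

Definition box_site d L (f : {ffun 'I_d -> 'I_(L.*2.+1)}) : site d :=
  \row_k ((f k : nat)%:Z - L%:Z).

Definition box d (L : nat) : {fset site d} :=
  [fset box_site f | f in {: {ffun 'I_d -> 'I_(L.*2.+1)}}]%fset.

Lemma mem_box d L (x : site d) : (x \in box d L) = [forall k, `|x 0 k| <= L%:Z].
Proof.
apply/imfsetP/forallP => /= [[f _ ->] k|xL].
  rewrite mxE ler_norml; apply/andP; split.
    by rewrite lerBrDr addrC subrr lez_nat.
  by rewrite lerBlDr -PoszD lez_nat addnn -ltnS.
have x_ge0 k : 0 <= x 0 k + L%:Z.
  by have := xL k; rewrite ler_norml -lerBlDr sub0r => /andP[].
have x_lt k : (`|(x 0 k + L%:Z)%R| < L.*2.+1)%N.
  rewrite ltnS -lez_nat gez0_abs// -addnn PoszD lerD2r.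
  by have := xL k; rewrite ler_norml => /andP[].
exists [ffun k => Ordinal (x_lt k)] => //.
by apply/rowP => k; rewrite mxE ffunE/= gez0_abs// addrK.
Qed.

Section pinning_measure.
Context {R : realType} (eps : {nonneg R}).

Definition pinning_measure : set (measurableTypeR R) -> \bar R :=
  measure_add (@lebesgue_measure R) (mscale eps (@dirac _ (measurableTypeR R) 0 R)).

HB.instance Definition _ := Measure.on pinning_measure.

Let pinning_sigma_finite : sigma_finite setT pinning_measure.
Proof.
have [F FT Foo] := sigma_finiteT (@lebesgue_measure R).
exists F => // i; have [mF Fi] := Foo i; split => //.
rewrite /pinning_measure measure_addE lte_add_pinfty//.
by rewrite lte_mul_pinfty// /dirac ltry.
Qed.

HB.instance Definition _ :=
  Measure_isSigmaFinite.Build _ _ _ pinning_measure pinning_sigma_finite.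

End pinning_measure.

Section cons_measure.
Context d (T : measurableType d) (R : realType) (n : nat).
Variables (nu : {sigma_finite_measure set T -> \bar R}).
Variables (m : {measure set (n.-tuple T) -> \bar R}).

Let rcons_fun (p : n.-tuple T * T) : n.+1.-tuple T := [tuple of p.2 :: p.1].

Let measurable_rcons_fun : measurable_fun [set: _] rcons_fun.
Proof. exact: measurable_cons. Qed.

Definition cons_measure : set (n.+1.-tuple T) -> \bar R :=
  pushforward (m \x nu)%E rcons_fun.

Let cons_measure0 : cons_measure set0 = 0%E.
Proof. by rewrite /cons_measure /pushforward preimage_set0 measure0. Qed.

Let cons_measure_ge0 A : (0 <= cons_measure A)%E.
Proof. exact: measure_ge0. Qed.

Let cons_measure_sigma_additive : semi_sigma_additive cons_measure.
Proof.
move=> F mF tF mUF; rewrite /cons_measure /pushforward preimage_bigcup.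
apply: measure_semi_sigma_additive.
- by move=> k; rewrite -[X in measurable X]setTI; exact: measurable_rcons_fun.
- apply/trivIsetP => /= i j _ _ ij; rewrite -preimage_setI.
  by move/trivIsetP : tF => /(_ _ _ _ _ ij) ->//; rewrite preimage_set0.
- rewrite -preimage_bigcup -[X in measurable X]setTI.
  exact: measurable_rcons_fun.
Qed.

HB.instance Definition _ := isMeasure.Build _ _ _ cons_measure
  cons_measure0 cons_measure_ge0 cons_measure_sigma_additive.

End cons_measure.

Fixpoint power_measure d (T : measurableType d) (R : realType)
    (nu : {sigma_finite_measure set T -> \bar R}) (n : nat) :
    {measure set (n.-tuple T) -> \bar R} :=
  match n with
  | 0 => @dirac _ _ [tuple] R
  | n'.+1 => cons_measure nu (power_measure nu n')
  end.

Section gibbs.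
Context {R : realType} {d : nat}.
Variables (V : R -> R) (eps : {nonneg R}) (Lambda : {fset site d}).
Variable eta : site d -> R.

(* phi_Lambda in R^Lambda, listed along the enumeration of Lambda. *)
Definition config := (#|{: Lambda}|.-tuple (measurableTypeR R)).

Definition height (phi : config) (i : Lambda) : R := tnth phi (enum_rank i).

(* Every nearest-neighbour pair {i, j} is counted once, as (i, i + e_k); this
   orientation matters only when V is not even. *)
Definition bulk_energy (phi : config) : R :=
  \sum_(i : Lambda) \sum_(j : Lambda | fsval j \in up_neighbours (fsval i))
    V (height phi i - height phi j).

Definition boundary_energy (phi : config) : R :=
  \sum_(i : Lambda) \sum_(j <- neighbours (fsval i) | j \notin Lambda)
    V (height phi i).

Definition boltzmann_weight (phi : config) : R :=
  expR (- (4 * d)%:R^-1 * bulk_energy phi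
        - (4 * d)%:R^-1 * boundary_energy phi
        + \sum_(i : Lambda) eta (fsval i) * height phi i).

Definition reference_measure : {measure set config -> \bar R} :=
  power_measure (pinning_measure eps) #|{: Lambda}|.

Definition partition_function : \bar R :=
  (\int[reference_measure]_phi (boltzmann_weight phi)%:E)%E.

(* Only a set function here: sigma-additivity needs V to be measurable, which is
   not assumed at this point. Lebesgue integration accepts such a set function. *)
Definition gibbs (A : set config) : \bar R :=
  (((fine partition_function)^-1)%:E *
   \int[reference_measure]_(phi in A) (boltzmann_weight phi)%:E)%E.

Definition gibbs_expectation (f : config -> R) : R :=
  fine (\int[gibbs]_phi (f phi)%:E)%E.

End gibbs.

Section random_fields.
Context d {T : measurableType d} {R : realType} (P : probability T R).

Definition mutually_independent (I : choiceType) (X : I -> {RV P >-> R}) :=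
  forall (J : {fset I}) (A : I -> set R),
    (forall i, i \in J -> measurable (A i)) ->
    (P (\bigcap_(i in [set` J]) (X i @^-1` A i)) =
     \prod_(i <- J) P (X i @^-1` A i))%E.

Definition identically_distributed (I : Type) (X : I -> {RV P >-> R}) :=
  forall (i j : I) (A : set R), measurable A ->
    distribution P (X i) A = distribution P (X j) A.

Definition symmetrically_distributed (X : {RV P >-> R}) :=
  forall A : set R, measurable A ->
    P (X @^-1` A) = P ((fun w => - X w) @^-1` A).

(* The Lebesgue integral of X is meaningful in [-oo, +oo], i.e. it is not of
   the form +oo - +oo. *)
Definition has_expectation (X : T -> R) :=
  (\int[P]_w ((EFin \o X)^\+ w) < +oo)%E \/
  (\int[P]_w ((EFin \o X)^\- w) < +oo)%E.

End random_fields.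

(* Main.v *)
Require Import Defs.
From HB Require Import structures.
From mathcomp Require Import all_boot all_order all_algebra.
From mathcomp Require Import finmap.
From mathcomp Require Import all_classical all_reals all_analysis.
From mathcomp Require Import measurable_realfun ring lra zify.

(** Write [Z_eps[h]] for the partition function in the field [h] and [mu_h] for
    the Gibbs measure. Jensen's inequality gives
    [<h, mu_h(phi)> >= ln Z_eps[h] - ln Z_eps[0]].
    Pinning is harmless: since [V'' <= 1], averaging over [phi_i -> - phi_i] shows
    that fixing a height at 0 costs at most a constant factor [C] compared with
    integrating it out, so [Z_0 <= Z_eps <= (1 + eps C)^|Lambda| Z_0] and the
    error is of order [L^2], negligible against [L^2 ln L].
    For [eps = 0], shifting [phi] by [+psi] and [-psi] and using
    [V(x + y) + V(x - y) <= 2 V(x) + y^2], Cauchy-Schwarz gives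
    [ln Z[h + z] + ln Z[h - z] >= 2 ln Z[h] + 2 <z, psi> - q(psi)]
    with [q] the discrete Dirichlet form. With [psi = K z] linear in [z], iterating
    this along [h, h/2, h/4, ...] yields
    [ln Z[h] - ln Z[0] >= <h, mu_0(phi)> + <h, K h> - q(K h) / 2].
    The linear term has mean zero, the field is uncorrelated, and [K] is built from
    truncated logarithms centred at the sites of the half-size box, whose height is
    of order [ln L] and whose Dirichlet energy is at most of order [ln L]. *)

Set Implicit Arguments.
Unset Strict Implicit.
Unset Printing Implicit Defensive.

Import Order.TTheory GRing.Theory Num.Theory.
Import numFieldNormedType.Exports.

Local Open Scope classical_set_scope.
Local Open Scope ring_scope.

(** * Power measures *)

(** Dimension two is what makes the logarithm appear: a bump of height of order [ln L] costs a
    Dirichlet energy of the same order, so a small multiple of it gains more than it costs, once for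
    each of order [L^2] sites. Pinning destroys translation invariance, so the shifts cannot be
    performed under the pinned measure. Jensen's inequality first reduces the overlap to a
    difference of [ln Z], where pinning is only a factor. The constant [a] comes from the kernel
    alone, hence depends neither on [eps] nor on the law of the fields. Averaging the midpoint bound
    over a field and its opposite would raise the question whether [ln Z] is integrable. The halving
    gives instead a bound for every single field, by a polynomial in that field, and second moments
    suffice to average it. Convexity of [ln Z] makes the overlap plus its image under the flip of
    one field nonnegative, which excludes the value [-oo]. *)

Section sigma_finite_of.
Context d (T : measurableType d) (R : realType).
Variables (m : {measure set T -> \bar R}) (sfm : sigma_finite setT m).

(** The proof is a phantom argument: it lets the alias carry the sigma-finite structure that
    Tonelli's theorem asks for and that the type of [m] does not record. *)
Definition sigma_finite_of (_ : sigma_finite setT m) : set T -> \bar R := m.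

HB.instance Definition _ := Measure.copy (sigma_finite_of sfm) m.
HB.instance Definition _ :=
  Measure_isSigmaFinite.Build _ _ _ (sigma_finite_of sfm) sfm.

End sigma_finite_of.

Section power_measure_theory.
Local Open Scope ereal_scope.
Context d (T : measurableType d) (R : realType).
Variable nu : {sigma_finite_measure set T -> \bar R}.

Lemma measurable_thead n : measurable_fun [set: n.+1.-tuple T] (@thead n T).
Proof. exact: measurable_tnth. Qed.

Lemma measurable_cons_pair n : measurable_fun [set: (n.-tuple T * T)%type]
  (fun p : n.-tuple T * T => [tuple of p.2 :: p.1]).
Proof. exact: measurable_cons. Qed.

(** A tuple is covered by the product of an increasing cover for the tail and one for the head: the
    larger of the two indices serves both. *)
Lemma power_measure_sigma_finite n : sigma_finite setT (power_measure nu n).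
Proof.
elim: n => [|n /sigma_finiteP[F' [F'T ndF F'm]]] /=.
  exists (fun=> setT); first by rewrite bigcup_const//; exists 0%N.
  move=> i; split; first exact: measurableT.
  by rewrite /= diracT ltry.
have /sigma_finiteP[G [GT ndG Gm]] := sigma_finiteT nu.
exists (fun k => [set t : n.+1.-tuple T | F' k [tuple of behead t] /\ G k (thead t)]).
  apply/seteqP; split=> // t _.
  have : (\bigcup_i F' i) [tuple of behead t] by rewrite -F'T.
  have : (\bigcup_i G i) (thead t) by rewrite -GT.
  move=> [i _ Gi] [j _ Fj]; exists (maxn i j) => //; split.
    by move/subsetPset: (ndF _ _ (leq_maxr i j)); exact.
  by move/subsetPset: (ndG _ _ (leq_maxl i j)); exact.
move=> k; have [mF Fk] := F'm k; have [mG Gk] := Gm k.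
split.
  apply: measurableI.
    rewrite -[X in measurable X]setTI; exact: (measurable_behead measurableT).
  rewrite -[X in measurable X]setTI; exact: (measurable_thead measurableT).
rewrite /cons_measure /pushforward.
rewrite [X in (_ \x _)%E X](_ : _ = F' k `*` G k); last first.
  apply/seteqP; split => [[t y]|[t y]] /=.
    rewrite theadE => -[h1 h2]; split=> //.
    by rewrite (_ : t = [tuple of behead (cons_tuple y t)])//; exact/val_inj.
  rewrite theadE => -[h1 h2]; split=> //.
  by rewrite (_ : [tuple of behead (cons_tuple y t)] = t)//; exact/val_inj.
rewrite product_measure1E// lte_mul_pinfty//.
by rewrite ge0_fin_numE.
Qed.

Let sf_power n : {sigma_finite_measure set (n.-tuple T) -> \bar R} :=
  sigma_finite_of (power_measure_sigma_finite n).

(** With the field as the parameter [s], this yields measurability of partition functions and Gibbs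
    means. *)
Lemma measurable_power_integral d' (S : measurableType d') n
    (f : S -> n.-tuple T -> \bar R) :
  measurable_fun [set: (S * n.-tuple T)%type]
    (fun p : S * n.-tuple T => f p.1 p.2) ->
  (forall s t, 0 <= f s t) ->
  measurable_fun setT (fun s => \int[power_measure nu n]_t f s t).
Proof.
move=> mf f0.
exact: (@measurable_fun_fubini_tonelli_F _ _ _ _ _ (sf_power n)
  (fun p : S * n.-tuple T => f p.1 p.2) mf (fun p => f0 p.1 p.2)).
Qed.

Lemma measurable_inner_integral n (f : n.+1.-tuple T -> \bar R) :
  measurable_fun setT f -> (forall x, 0 <= f x) ->
  measurable_fun setT (fun t : n.-tuple T => \int[nu]_y f [tuple of y :: t]).
Proof.
move=> mf f0.
apply: (@measurable_fun_fubini_tonelli_F _ _ _ _ _ nu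
  (fun p : n.-tuple T * T => f [tuple of p.2 :: p.1])) => //.
apply: (measurableT_comp mf); exact: measurable_cons_pair.
Qed.

Lemma integral_power_measureS n (f : n.+1.-tuple T -> \bar R) :
  measurable_fun setT f -> (forall x, 0 <= f x) ->
  \int[power_measure nu n.+1]_t f t =
  \int[power_measure nu n]_t \int[nu]_y f [tuple of y :: t].
Proof.
move=> mf f0 /=.
rewrite (@ge0_integral_pushforward _ _ _ _ _ _ (@measurable_cons_pair n)
  (power_measure nu n \x nu) setT f)// preimage_setT.
rewrite (@fubini_tonelli1 _ _ _ _ _ (sf_power n) nu)//.
  apply: (measurableT_comp mf); exact: measurable_cons_pair.
by move=> x /=.
Qed.

End power_measure_theory.

(** * Translations and pinned reference measures *)

Section lebesgue_translation.
Local Open Scope ereal_scope.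
Context {R : realType}.
Notation TR := (measurableTypeR R).

Lemma lebesgue_measure_shift (a : R) (A : set TR) : measurable A ->
  pushforward (@lebesgue_measure R) (fun x : TR => (x + a)%R : TR) A =
  lebesgue_measure A.
Proof.
have mshift : @measurable_fun _ _ TR TR setT (fun x : R => x + a)%R.
  exact: measurable_funD.
pose mshift' := isMeasurableFun.Build _ _ _ _ _ mshift.
pose g : {mfun TR >-> TR} := HB.pack (fun x : R => x + a)%R mshift'.
move=> mA; apply/esym.
apply: (@lebesgue_measure_unique R (pushforward (@lebesgue_measure R) g)) => //.
move=> X [[x y] _ <-] /=.
rewrite /pushforward.
rewrite [X in _ = lebesgue_measure X](_ : _ = `](x - a)%R, (y - a)%R]%classic).
  rewrite !lebesgue_measure_itv/= !lte_fin ltrD2r.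
  by case: ifPn => // _; rewrite -!EFinD; congr (_%:E); lra.
by apply/seteqP; split => z /=; rewrite !in_itv /= ltrBlDr lerBrDr.
Qed.

Lemma ge0_integral_lebesgue_shift (a : R) (f : TR -> \bar R) :
  measurable_fun setT f -> (forall x, 0 <= f x) ->
  \int[lebesgue_measure]_x f (x + a)%R = \int[lebesgue_measure]_x f x.
Proof.
move=> mf f0.
have mshift : @measurable_fun _ _ TR TR setT (fun x : R => x + a)%R.
  exact: measurable_funD.
pose mshift' := isMeasurableFun.Build _ _ _ _ _ mshift.
pose g : {mfun TR >-> TR} := HB.pack (fun x : R => x + a)%R mshift'.
rewrite [RHS](eq_measure_integral (pushforward (@lebesgue_measure R) g)).
  by rewrite ge0_integral_pushforward.
by move=> A mA _; exact/esym/lebesgue_measure_shift.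
Qed.

Lemma ge0_integral_pinning (eps : {nonneg R}) (f : TR -> \bar R) :
  measurable_fun setT f -> (forall x, 0 <= f x) ->
  \int[pinning_measure eps]_x f x =
  \int[lebesgue_measure]_x f x + (eps%:num)%:E * f 0%R.
Proof.
move=> mf f0; rewrite /pinning_measure ge0_integral_measure_add//.
rewrite ge0_integral_mscale//; congr (_ + _ * _).
by rewrite integral_dirac// diracT mul1e.
Qed.

Lemma ge0_integral_pinning0 (f : TR -> \bar R) :
  measurable_fun setT f -> (forall x, 0 <= f x) ->
  \int[pinning_measure (0%:nng)%R]_x f x = \int[lebesgue_measure]_x f x.
Proof. by move=> mf f0; rewrite ge0_integral_pinning// mul0e adde0. Qed.

End lebesgue_translation.

Section tuple_moves.
Context {R : realType}.
Notation TR := (measurableTypeR R).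

Definition addt n (t u : n.-tuple TR) : n.-tuple TR :=
  [tuple (tnth t i + tnth u i : R) | i < n].

Definition scalet n (a : R) (t : n.-tuple TR) : n.-tuple TR :=
  [tuple a * tnth t i : R | i < n].

Definition sett n (t : n.-tuple TR) (i : 'I_n) (s : R) : n.-tuple TR :=
  [tuple if j == i then s else tnth t j | j < n].

Lemma addt_cons n (y a : R) (t u : n.-tuple TR) :
  addt ([tuple of (y : TR) :: t]) ([tuple of (a : TR) :: u]) =
    [tuple of (y + a : TR) :: (addt t u)].
Proof.
apply: eq_from_tnth => i; rewrite tnth_mktuple.
by case: (unliftP ord0 i) => [j|] ->; rewrite ?tnthS ?tnth0// tnth_mktuple.
Qed.

Lemma sett_cons0 n (y s : R) (t : n.-tuple TR) :
  sett ([tuple of (y : TR) :: t]) ord0 s = [tuple of (s : TR) :: t].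
Proof.
apply: eq_from_tnth => i; rewrite tnth_mktuple.
by case: (unliftP ord0 i) => [j|] ->; rewrite ?tnthS ?tnth0.
Qed.

Lemma sett_consS n (y s : R) (t : n.-tuple TR) (i : 'I_n) :
  sett ([tuple of (y : TR) :: t]) (lift ord0 i) s = [tuple of (y : TR) :: (sett t i s)].
Proof.
apply: eq_from_tnth => k; rewrite tnth_mktuple.
case: (unliftP ord0 k) => [j|] ->; rewrite ?tnthS ?tnth0//.
by rewrite tnth_mktuple (inj_eq lift_inj).
Qed.

Lemma measurable_addt n (u : n.-tuple TR) : 
  measurable_fun setT (fun t : n.-tuple TR => addt t u).
Proof.
apply/measurable_fun_tnthP => i.
rewrite (_ : _ \o _ = fun t => tnth t i + tnth u i).
  by apply: measurable_funD => //; exact: measurable_tnth.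
by apply/funext => t /=; rewrite tnth_mktuple.
Qed.

End tuple_moves.

Section power_lebesgue.
Local Open Scope ereal_scope.
Context {R : realType}.
Notation TR := (measurableTypeR R).

Lemma ge0_integral_power_shift n (f : n.-tuple TR -> \bar R) (u : n.-tuple TR) :
  measurable_fun setT f -> (forall t, 0 <= f t) ->
  \int[power_measure (@pinning_measure R (0%:nng)%R) n]_t f (addt t u) =
  \int[power_measure (@pinning_measure R (0%:nng)%R) n]_t f t.
Proof.
elim: n f u => [|n IH] f u mf f0.
  by apply: eq_integral => t _; rewrite (tuple0 (addt t u)) (tuple0 t).
rewrite integral_power_measureS//; last first.
  by apply: (measurableT_comp mf); exact: measurable_addt.
rewrite integral_power_measureS//.
rewrite -(IH (fun t => \int[pinning_measure (0%:nng)%R]_y f [tuple of y :: t])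
  [tuple of behead u]); last 2 first.
  exact: measurable_inner_integral.
  by move=> t; apply: integral_ge0.
apply: eq_integral => t _.
rewrite (tuple_eta u).
under eq_integral do rewrite addt_cons.
have mfc (v : n.-tuple TR) : @measurable_fun _ _ TR _ setT (fun y : TR => f [tuple
  of y :: v]).
  by apply: (measurableT_comp mf); exact: measurable_cons.
have mfa := measurableT_comp (mfc (addt t [tuple of behead u])).
rewrite !ge0_integral_pinning0//.
- rewrite (@ge0_integral_lebesgue_shift R (thead u)
    (fun y => f [tuple of y :: (addt t [tuple of behead u])]))//.
  rewrite (_ : [tuple of behead [tuple of thead u :: [tuple of behead u]]] =
    [tuple of behead u])//.
  by apply/val_inj.
- by apply: mfa; apply: measurable_funD.
Qed.

End power_lebesgue.

(** * Cost of pinning and finiteness of product integrals *)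

Section pinning_comparison.
Local Open Scope ereal_scope.
Context {R : realType}.
Notation TR := (measurableTypeR R).
Notation leb := (@lebesgue_measure R).

Lemma measurable_sett n (t : n.-tuple TR) (i : 'I_n) :
  @measurable_fun _ _ TR _ setT (fun s : TR => sett t i s).
Proof.
apply/measurable_fun_tnthP => j.
have [<-|ji] := eqVneq j i.
  rewrite (_ : _ \o _ = id); first exact: measurable_id.
  by apply/funext => s /=; rewrite tnth_mktuple eqxx.
rewrite (_ : _ \o _ = cst (tnth t j)); first exact: measurable_cst.
by apply/funext => s /=; rewrite tnth_mktuple (negbTE ji).
Qed.

Lemma ge0_integral_power_pinning0S n (w : n.+1.-tuple TR -> \bar R) :
  measurable_fun setT w -> (forall t, 0 <= w t) ->
  \int[power_measure (@pinning_measure R (0%:nng)%R) n.+1]_t w t =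
  \int[power_measure (@pinning_measure R (0%:nng)%R) n]_t \int[leb]_y w [tuple of y
    :: t].
Proof.
move=> mw w0; rewrite integral_power_measureS//.
apply: eq_integral => t _; rewrite ge0_integral_pinning0//.
by apply: (measurableT_comp mw); exact: measurable_cons.
Qed.

(** Each coordinate trades its atom [eps * w(0)] for [eps * C] times a Lebesgue integral, whence one
    factor [1 + eps * C]. The induction hypothesis is applied to [w] with its head integrated
    against Lebesgue measure; this function inherits the assumption on [sett] by exchanging two
    integrals. *)
Lemma pinning_power_le n (eps : {nonneg R}) (C : R) (w : n.-tuple TR -> \bar R) :
  (0 <= C)%R -> measurable_fun setT w -> (forall t, 0 <= w t) ->
  (forall t i, w (sett t i 0%R) <= C%:E * \int[leb]_s w (sett t i s)) ->
  \int[power_measure (pinning_measure eps) n]_t w t <=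
  ((1 + eps%:num * C) ^+ n)%:E *
  \int[power_measure (@pinning_measure R (0%:nng)%R) n]_t w t.
Proof.
move=> C0; elim: n w => [|n IH] w mw w0 wC; first by rewrite expr0 mul1e.
have mwc (v : n.-tuple TR) : @measurable_fun _ _ TR _ setT (fun y : TR => w [tuple
  of y :: v]).
  by apply: (measurableT_comp mw); exact: measurable_cons.
have mg : measurable_fun setT (fun t : n.-tuple TR => \int[leb]_y w [tuple of y :: t]).
  exact: measurable_inner_integral.
have g0 (t : n.-tuple TR) : 0 <= \int[leb]_y w [tuple of y :: t] by exact: integral_ge0.
rewrite ge0_integral_power_pinning0S// integral_power_measureS// exprS EFinM -muleA.
have K0 : (0 <= 1 + eps%:num * C)%R by rewrite addr_ge0// mulr_ge0.
apply: (@le_trans _ _ (\int[power_measure (pinning_measure eps) n]_t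
   ((1 + eps%:num * C)%:E * \int[leb]_y w [tuple of y :: t]))).
  apply: ge0_le_integral => //.
  - by move=> t _; exact: integral_ge0.
  - exact: measurable_inner_integral.
  - by apply: emeasurable_funM.
  move=> t _; rewrite ge0_integral_pinning// EFinD ge0_muleDl//; last first.
    by rewrite lee_fin mulr_ge0.
  rewrite mul1e leeD2l// EFinM -muleA lee_wpmul2l ?lee_fin//.
  have := wC [tuple of 0%R :: t] ord0; rewrite sett_cons0 => /le_trans; apply.
  by under eq_integral do rewrite sett_cons0.
rewrite ge0_integralZl//.
apply: lee_wpmul2l; first by rewrite lee_fin.
apply: IH => // t i.
have mw2 : measurable_fun setT (fun p : TR * TR => w [tuple of p.1 :: sett t i p.2]).
  apply: (measurableT_comp mw); apply: measurable_cons => //.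
  by apply: (measurableT_comp (measurable_sett t i)).
pose h (y : TR) := \int[leb]_s w [tuple of y :: sett t i s].
have mh : measurable_fun setT h.
  by apply: (@measurable_fun_fubini_tonelli_F _ _ TR TR R leb _ mw2).
have h0 y : 0 <= h y by exact: integral_ge0.
apply: (@le_trans _ _ (\int[leb]_y (C%:E * h y))).
  apply: ge0_le_integral => //.
  - exact: emeasurable_funM.
  move=> y _; have := wC [tuple of y :: t] (lift ord0 i).
  by rewrite sett_consS; under eq_integral do rewrite sett_consS.
rewrite (ge0_integralZl leb measurableT mh (fun y _ => h0 y)); last by rewrite lee_fin.
apply: lee_wpmul2l; first by rewrite lee_fin.
by rewrite /h (@fubini_tonelli _ _ TR TR R leb leb _ mw2).
Qed.

Lemma power_lebesgue_lty n (f : TR -> R) :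
  measurable_fun setT f -> (forall x, 0 <= f x)%R ->
  \int[leb]_x (f x)%:E < +oo ->
  \int[power_measure (@pinning_measure R (0%:nng)%R) n]_t
     (\prod_(i < n) f (tnth t i))%:E < +oo.
Proof.
move=> mf f0 foo; elim: n => [|n IH].
  rewrite /= integral_dirac//; last first.
    by under eq_fun do rewrite big_ord0; exact: measurable_cst.
  by rewrite diracT big_ord0 mul1e ltry.
have mprod m : measurable_fun [set: m.-tuple TR] (fun t => (\prod_(i < m) f (tnth t
  i))%:E).
  apply/measurable_EFinP; apply: measurable_prod => i _.
  apply: (measurableT_comp mf); exact: measurable_tnth.
have prod0 m (t : m.-tuple TR) : 0 <= (\prod_(i < m) f (tnth t i))%:E.
  by rewrite lee_fin prodr_ge0.
have I0 : 0 <= \int[leb]_x (f x)%:E.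
  by apply: integral_ge0 => x _; rewrite lee_fin.
rewrite ge0_integral_power_pinning0S//.
rewrite (eq_integral (fun t : n.-tuple TR =>
    (\int[leb]_x (f x)%:E) * (\prod_(i < n) f (tnth t i))%:E)); last first.
  move=> t _; rewrite muleC -ge0_integralZl//.
  - apply: eq_integral => y _; rewrite big_ord_recl tnth0 mulrC EFinM.
    by congr (_%:E * _); apply: eq_bigr => i _; rewrite tnthS.
  - exact/measurable_EFinP.
  - by move=> x _; rewrite lee_fin.
rewrite (ge0_integralZl (power_measure _ n) measurableT (mprod n) (fun t _ => prod0
  n t) I0).
by apply: lte_mul_pinfty => //; rewrite ge0_fin_numE.
Qed.

(** By symmetry this is twice a half-line integral, which is bounded by the total mass 1 of the
    exponential law of rate 1. *)
Lemma integral_expRN_lty : \int[leb]_x (expR (- `|x|))%:E < +oo.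
Proof.
rewrite ge0_symfun_integralT; last 3 first.
- by move=> x; exact: expR_ge0.
- move=> x; apply: continuous_comp; last exact: continuous_expR.
  apply: continuousN; exact: norm_continuous.
- by move=> x /=; rewrite normrN.
apply: lte_mul_pinfty; [by rewrite lee_fin|by []|].
apply: (@le_lt_trans _ _ 1); last exact: ltry.
rewrite -(@integral_exponential_pdf R 1 ltr01).
apply: (@le_trans _ _ (\int[leb]_(x in [set x | (0 <= x)%R]) (exponential_pdf 1 x)%:E)).
  rewrite le_eqVlt; apply/orP; left; apply/eqP.
  apply: eq_integral => x; rewrite inE/= => x0.
  by rewrite exponential_pdfE// mul1r mulN1r ger0_norm.
apply: ge0_subset_integral => //.
- by rewrite -set_itvcy.
- by apply/measurable_EFinP; exact: measurable_exponential_pdf.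
- by move=> x _; rewrite lee_fin exponential_pdf_ge0.
Qed.
End pinning_comparison.

(** * Densities and integrals *)

Section density.
Local Open Scope ereal_scope.
Context d (T : measurableType d) (R : realType).
Variables (m : {measure set T -> \bar R}) (g : T -> R).
Hypotheses (mg : measurable_fun setT g) (g0 : forall x, (0 <= g x)%R).

(** The two proofs are arguments because the measure structure attached below depends on them. The
    set function [gibbs] is later recognised as a multiple of such a density. *)
Definition density of measurable_fun setT g & (forall x, (0 <= g x)%R) :=
  fun A : set T => \int[m]_(x in A) (g x)%:E.

Let dens := density mg g0.

Let dens0 : dens set0 = 0.
Proof. by rewrite /dens /density integral_set0. Qed.

Let dens_ge0 A : 0 <= dens A.
Proof. by apply: integral_ge0 => x _; rewrite lee_fin. Qed.

Let dens_sigma_additive : semi_sigma_additive dens.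
Proof.
move=> F mF tF mUF; rewrite /dens /density ge0_integral_bigcup//.
- by apply: is_cvg_nneseries => n _ _; exact: dens_ge0.
- exact/measurable_EFinP/measurable_funTS.
- by move=> x _; rewrite lee_fin.
Qed.

HB.instance Definition _ :=
  isMeasure.Build _ _ _ dens dens0 dens_ge0 dens_sigma_additive.

Import HBNNSimple.

Lemma ge0_integral_density (f : T -> \bar R) :
  measurable_fun setT f -> (forall x, 0 <= f x) ->
  \int[dens]_x f x = \int[m]_x (f x * (g x)%:E).
Proof.
move=> mf f0; pose h := nnsfun_approx measurableT mf.
have hf x : (EFin \o h^~ x) n @[n --> \oo] --> f x.
  by apply: cvg_nnsfun_approx => //.
transitivity (limn (fun n => \int[dens]_x (h n x)%:E)).
  rewrite -monotone_convergence//=.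
  - by apply: eq_integral => x _; apply/esym/cvg_lim => //; exact: hf.
  - by move=> n; exact/measurable_EFinP/measurable_funP.
  - by move=> n x _; rewrite lee_fin.
  - by move=> x _ a b ab; rewrite lee_fin; exact/lefP/nd_nnsfun_approx.
transitivity (limn (fun n => \int[m]_x ((h n x)%:E * (g x)%:E))); last first.
  rewrite -monotone_convergence//=.
  - apply: eq_integral => x _; apply/cvg_lim => //.
    by apply: cvgeZr => //; exact: hf.
  - by move=> n; apply/emeasurable_funM; apply/measurable_EFinP => //;
    exact/measurable_funP.
  - by move=> n x _; rewrite mule_ge0// lee_fin.
  - move=> x _ a b ab; rewrite lee_wpmul2r ?lee_fin//; exact/lefP/nd_nnsfun_approx.
congr (limn _); apply/funext => n.
rewrite integralT_nnsfun sintegralE.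
under [RHS]eq_integral => x _.
  rewrite fimfunE -fsumEFin// ge0_mule_fsuml; last first.
    by move=> r; rewrite EFinM nnfun_muleindic_ge0.
  over.
rewrite ge0_integral_fsum//; last 2 first.
- move=> r; apply: emeasurable_funM; last exact/measurable_EFinP.
  by apply/measurable_EFinP; apply/measurable_funM.
- by move=> r x _; apply: mule_ge0; [rewrite EFinM nnfun_muleindic_ge0|rewrite lee_fin].
apply: eq_fsbigr => r /[!inE] -[x0 _ hr].
have r0 : (0 <= r)%R by rewrite -hr.
transitivity (r%:E * \int[m]_x (((fun x => (g x)%:E) \_ (h n @^-1` [set r])) x)).
  by rewrite -integral_mkcond.
rewrite -(ge0_integralZl m measurableT) ?lee_fin//; last 2 first.
- apply/(measurable_restrictT _ _).1 => //.
  exact/measurable_EFinP/measurable_funTS.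
- by move=> x _; apply: erestrict_ge0 => y _; rewrite lee_fin.
apply: eq_integral => x _; rewrite patchE indicE; case: ifPn => _.
  by rewrite mulr1.
by rewrite mulr0 mule0 mul0e.
Qed.

(** Valid for any measurable [f], integrable or not: a nonnegative [g] commutes with taking positive
    and negative parts, and the integral is by definition the difference of the two. *)
Lemma integral_density (f : T -> R) :
  measurable_fun setT f ->
  \int[dens]_x (f x)%:E = \int[m]_x (f x * g x)%:E.
Proof.
move=> mf; rewrite [LHS]integralE [RHS]integralE; congr (_ - _).
- rewrite ge0_integral_density//; last exact/measurable_funepos/measurable_EFinP.
  apply: eq_integral => x _; rewrite !funeposE /= EFinM.
  by rewrite maxe_pMl// ?lee_fin// mul0e.
- rewrite ge0_integral_density//; last exact/measurable_funeneg/measurable_EFinP.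
  apply: eq_integral => x _; rewrite !funenegE /= -mulNr EFinM.
  by rewrite maxe_pMl// ?lee_fin// mul0e.
Qed.

End density.

(** * Gibbs weights *)

Section has_integral.
Context d (T : measurableType d) (R : realType) (m : {measure set T -> \bar R}).
Implicit Types f g : T -> R.

(** Integrability and value travel together, so that linear combinations and comparisons of
    integrals become statements on real numbers. *)
Definition has_integral f (v : R) :=
  m.-integrable setT (EFin \o f) /\ (\int[m]_x (f x)%:E = v%:E)%E.

Lemma has_integral_integrable f : m.-integrable setT (EFin \o f) ->
  has_integral f (fine (\int[m]_x (f x)%:E)%E).
Proof.
move=> If; split=> //; rewrite fineK//.
exact: (integrable_fin_num measurableT If).
Qed.

Lemma has_integral_ge0 f : measurable_fun setT f -> (forall x, 0 <= f x) ->
  (\int[m]_x (f x)%:E < +oo)%E -> has_integral f (fine (\int[m]_x (f x)%:E)%E).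
Proof.
move=> mf f0 foo; apply: has_integral_integrable.
apply/integrableP; split; first exact/measurable_EFinP.
by under eq_integral do rewrite gee0_abs ?lee_fin//.
Qed.

Lemma has_integral_ext f g v : f =1 g -> has_integral f v -> has_integral g v.
Proof. by move=> /funext ->. Qed.

Lemma has_integral_unique f v w : has_integral f v -> has_integral f w -> v = w.
Proof. by move=> [_ fv] [_]; rewrite fv => -[]. Qed.

Lemma has_integralD f g v w : has_integral f v -> has_integral g w ->
  has_integral (fun x => f x + g x) (v + w).
Proof.
move=> [If fv] [Ig gw]; split; first exact: (integrableD measurableT If Ig).
rewrite (_ : (fun x => _) = (EFin \o f) \+ (EFin \o g))%E//.
by rewrite (integralD measurableT If Ig) /= fv gw.
Qed.

Lemma has_integralZ (a : R) f v : has_integral f v ->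
  has_integral (fun x => a * f x) (a * v).
Proof.
move=> [If fv]; split; first exact: (integrableZl measurableT a If).
rewrite EFinM -fv -(integralZl measurableT If).
by apply: eq_integral => x _; rewrite EFinM.
Qed.

Lemma has_integral0 : has_integral (fun=> 0) 0.
Proof.
split; first exact: (integrable0 m).
by rewrite integral0.
Qed.

Lemma has_integral_sum (I : Type) (s : seq I) (p : pred I) (F : I -> T -> R) v :
  (forall i, p i -> has_integral (F i) (v i)) ->
  has_integral (fun x => \sum_(i <- s | p i) F i x) (\sum_(i <- s | p i) v i).
Proof.
move=> Fv; elim: s => [|i s IH].
  rewrite big_nil; apply: has_integral_ext has_integral0 => x.
  by rewrite big_nil.
rewrite big_cons; case: ifPn => pi.
  apply: has_integral_ext (has_integralD (Fv _ pi) IH) => x.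
  by rewrite big_cons pi.
apply: has_integral_ext IH => x.
by rewrite big_cons (negbTE pi).
Qed.

Lemma has_integral_le f g v w : has_integral f v -> has_integral g w ->
  (forall x, f x <= g x) -> v <= w.
Proof.
move=> [If fv] [Ig gw] fg.
rewrite -lee_fin -fv -gw; apply: (le_integral measurableT If Ig).
by move=> x _; rewrite lee_fin.
Qed.

Lemma integrable_dominated f g : measurable_fun setT f ->
  (forall x, `|f x| <= g x) -> m.-integrable setT (EFin \o g) ->
  m.-integrable setT (EFin \o f).
Proof.
move=> mf fg; apply: (le_integrable measurableT); first exact/measurable_EFinP.
move=> x _ /=; rewrite lee_fin; apply: (le_trans (fg x)); exact: ler_norm.
Qed.

End has_integral.

Section gibbs_weight.
Context {R : realType} (n : nat).
Notation TR := (measurableTypeR R).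
Variables (m : {measure set (n.-tuple TR) -> \bar R}) (H : n.-tuple TR -> R).
Hypothesis mH : measurable_fun setT H.

Definition dot (h phi : n.-tuple TR) : R := \sum_(i < n) (tnth h i : R) * tnth phi i.

Definition weight h phi : R := expR (- H phi + dot h phi).

Definition partition_fn h : R := fine (\int[m]_phi (weight h phi)%:E)%E.

Definition mean h i : R :=
  fine (\int[m]_phi ((tnth phi i : R) * weight h phi)%:E)%E / partition_fn h.

Lemma weight_gt0 h phi : 0 < weight h phi. Proof. exact: expR_gt0. Qed.

Lemma measurable_weight h : measurable_fun setT (weight h).
Proof.
apply: (measurableT_comp (@measurable_expR R)).
apply: measurable_funD; first exact: measurableT_comp.
apply: measurable_sum => i; apply: measurable_funM => //.
exact: measurable_tnth.
Qed.

Hypothesis Wlty : forall h, (\int[m]_phi (weight h phi)%:E < +oo)%E.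
Hypothesis Wgt0 : forall h, (0 < \int[m]_phi (weight h phi)%:E)%E.

Lemma partition_fnE h : has_integral m (weight h) (partition_fn h).
Proof.
apply: has_integral_ge0 => //; first exact: measurable_weight.
by move=> x; rewrite ltW// weight_gt0.
Qed.

Lemma partition_fn_gt0 h : 0 < partition_fn h.
Proof. by have [_ E] := partition_fnE h; move: (Wgt0 h); rewrite E lte_fin. Qed.

Lemma dotDl h k phi : dot (addt h k) phi = dot h phi + dot k phi.
Proof.
rewrite /dot -big_split/=; apply: eq_bigr => i _.
by rewrite tnth_mktuple mulrDl.
Qed.

Lemma dotDr h phi psi : dot h (addt phi psi) = dot h phi + dot h psi.
Proof.
rewrite /dot -big_split/=; apply: eq_bigr => i _.
by rewrite tnth_mktuple mulrDr.
Qed.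

Lemma dotZl a h phi : dot (scalet a h) phi = a * dot h phi.
Proof.
rewrite /dot mulr_sumr; apply: eq_bigr => i _.
by rewrite tnth_mktuple mulrA.
Qed.

Lemma dotZr a h phi : dot h (scalet a phi) = a * dot h phi.
Proof.
rewrite /dot mulr_sumr; apply: eq_bigr => i _.
by rewrite tnth_mktuple mulrCA.
Qed.

Definition deltat i (s : R) : n.-tuple TR := [tuple if j == i then s else 0 | j < n].

Lemma dot_deltat i s phi : dot (deltat i s) phi = s * tnth phi i.
Proof.
rewrite /dot (bigD1 i)//= tnth_mktuple eqxx big1 ?addr0// => j ji.
by rewrite tnth_mktuple (negbTE ji) mul0r.
Qed.

(** Since [|t| <= exp t + exp (- t)], the integrand is dominated by the sum of the weights in the
    fields [h] plus and minus the unit field at [i], both of finite mass. *)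
Lemma coord_integrable h i :
  m.-integrable setT (EFin \o (fun phi : n.-tuple TR => (tnth phi i : R) * weight h
    phi)).
Proof.
have [I1 _] := has_integralD (partition_fnE (addt h (deltat i 1)))
   (partition_fnE (addt h (deltat i (-1)))).
apply: integrable_dominated I1.
  apply: measurable_funM; first exact: measurable_tnth.
  exact: measurable_weight.
move=> phi; rewrite normrM (gtr0_norm (weight_gt0 _ _)).
rewrite /weight !dotDl !dot_deltat mul1r mulN1r !addrA.
rewrite ![expR (_ + dot h phi + _)]expRD -mulrDr mulrC ler_pM2l ?expR_gt0//.
set t : R := tnth phi i.
have := expR_ge1Dx t; have := expR_ge1Dx (- t).
have := expR_gt0 t; have := expR_gt0 (- t).
by case: (ltrgt0P t) => _; lra.
Qed.

Lemma meanE h i : has_integral m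
  (fun phi : n.-tuple TR => (tnth phi i : R) * weight h phi) (partition_fn h * mean
    h i).
Proof.
have I := has_integral_integrable (coord_integrable h i).
by rewrite /mean mulrC divfK// gt_eqF// partition_fn_gt0.
Qed.

End gibbs_weight.

(** * Convexity of [ln Z] and its quadratic lower bound *)

Section quadratic_bound.
Context {R : realType} (n : nat).
Notation TR := (measurableTypeR R).
Variables (m : {measure set (n.-tuple TR) -> \bar R}) (H : n.-tuple TR -> R).
Hypothesis mH : measurable_fun setT H.
Variables (Z : n.-tuple TR -> R) (M : n.-tuple TR -> 'I_n -> R).
Hypothesis ZE : forall h, has_integral m (weight H h) (Z h).
Hypothesis Z_gt0 : forall h, 0 < Z h.
Hypothesis ME : forall h i, has_integral m
  (fun phi : n.-tuple TR => (tnth phi i : R) * weight H h phi) (Z h * M h i).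

(* Jensen's inequality, in the form exp X >= exp c * (1 + X - c) with c the
   Gibbs mean of X. *)
Lemma lnZ_jensen (h h' : n.-tuple TR) :
  \sum_(i < n) ((tnth h' i : R) - tnth h i) * M h i <=
  ln (Z h') - ln (Z h).
Proof.
set c := \sum_(i < n) _.
rewrite -ln_div ?posrE ?Z_gt0// -[leLHS]expRK ler_ln ?posrE ?expR_gt0 ?divr_gt0
  ?Z_gt0//.
rewrite ler_pdivlMr ?Z_gt0//.
have IX : has_integral m (fun phi => expR c * (1 - c) * weight H h phi +
    expR c * \sum_(i < n) ((tnth h' i : R) - tnth h i) * (tnth phi i * weight H h phi))
    (expR c * (1 - c) * Z h +
     expR c * \sum_(i < n) ((tnth h' i : R) - tnth h i) * (Z h * M h i)).
  apply: has_integralD; first exact/has_integralZ/ZE.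
  apply: has_integralZ; apply: has_integral_sum => i _.
  exact/has_integralZ/ME.
have := has_integral_le IX (ZE h') _.
rewrite (_ : \sum_(i < n) _ = Z h * c); last first.
  by rewrite mulr_sumr; apply: eq_bigr => i _; rewrite mulrCA.
rewrite (_ : _ + _ = expR c * Z h); last by ring.
apply => phi.
rewrite (_ : \sum_(i < n) _ = weight H h phi * (dot h' phi - dot h phi)); last first.
  rewrite -sumrB mulr_sumr; apply: eq_bigr => i _; ring.
set X := dot h' phi - dot h phi.
rewrite (_ : weight H h' phi = weight H h phi * expR X); last first.
  by rewrite /weight -expRD; congr expR; rewrite /X; ring.
rewrite (_ : _ + _ = weight H h phi * (expR c * (1 + (X - c)))); last by ring.
rewrite ler_pM2l ?weight_gt0//.
rewrite -[X in _ <= expR X](subrKC c) expRD ler_pM2l ?expR_gt0//.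
exact: expR_ge1Dx.
Qed.

(** Gradient monotonicity of the convex function [ln Z], obtained by adding Jensen's inequality from
    [h] to [h'] and the one from [h'] to [h]. *)
Lemma mean_monotone (h h' : n.-tuple TR) :
  0 <= \sum_(i < n) ((tnth h' i : R) - tnth h i) * (M h' i - M h i).
Proof.
pose a := ln (Z h) - ln (Z h').
have A := lnZ_jensen h h'.
have B := lnZ_jensen h' h.
have E : \sum_(i < n) ((tnth h' i : R) - tnth h i) * (M h' i - M h i) =
  - (\sum_(i < n) ((tnth h i : R) - tnth h' i) * M h' i) -
  \sum_(i < n) ((tnth h' i : R) - tnth h i) * M h i.
  rewrite -sumrN -sumrB; apply: eq_bigr => i _.
  rewrite mulrBr; congr (_ - _).
  by rewrite -mulNr opprB.
rewrite E subr_ge0 (le_trans A)// lerNr opprB.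
exact: B.
Qed.

Hypothesis shift_inv : forall (f : n.-tuple TR -> \bar R) (u : n.-tuple TR),
  measurable_fun setT f -> (forall t, 0 <= f t)%E ->
  (\int[m]_t f (addt t u) = \int[m]_t f t)%E.
Variable q : n.-tuple TR -> R.
Hypothesis Hq : forall phi psi,
  H (addt phi psi) + H (addt phi (scalet (-1) psi)) <= 2 * H phi + q psi.

(** This uses translation invariance of the reference measure, which an atom at 0 would break; the
    bounds that follow are therefore applied with pinning strength 0 only. *)
Lemma ZE_shift h u : has_integral m (fun phi => weight H h (addt phi u)) (Z h).
Proof.
have mf := measurable_weight mH h.
have mfe : measurable_fun setT (fun phi => (weight H h phi)%:E)
  by exact/measurable_EFinP.
have f0 t : (0 <= (weight H h t)%:E)%E by rewrite lee_fin ltW// weight_gt0.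
have E := shift_inv u mfe f0.
have [_ ZhE] := ZE h.
have := @has_integral_ge0 _ _ _ m (fun phi => weight H h (addt phi u)).
rewrite E ZhE; apply.
- apply: (measurableT_comp mf); exact: measurable_addt.
- by move=> x; rewrite ltW// weight_gt0.
- exact: ltry.
Qed.

(* Cauchy-Schwarz for the two shifted weights, written as AM-GM after
   normalisation. *)
Lemma lnZ_midpoint h z psi :
  2 * ln (Z h) + 2 * dot z psi - q psi <=
  ln (Z (addt h z)) + ln (Z (addt h (scalet (-1) z))).
Proof.
set Pp := Z (addt h z); set Pm := Z (addt h (scalet (-1) z)).
have Pp0 : 0 < Pp by exact: Z_gt0.
have Pm0 : 0 < Pm by exact: Z_gt0.
have Ph0 : 0 < Z h by exact: Z_gt0.
set u := ln Pp; set v := ln Pm.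
(* [K * weight H h] bounds from below the geometric mean of the two shifted weights, each normalised
   to have integral 1. *)
pose K := expR (- (u + v) / 2 - q psi / 2 + dot z psi).
have I1 := has_integralD (has_integralZ (Pp^-1) (ZE_shift (addt h z) psi))
  (has_integralZ (Pm^-1) (ZE_shift (addt h (scalet (-1) z)) (scalet (-1) psi))).
rewrite -/Pp -/Pm !mulVf ?gt_eqF// in I1.
have I2 := has_integralZ (2 * K) (ZE h).
have : 2 * K * Z h <= 1 + 1.
  apply: has_integral_le I2 I1 _ => phi.
  have -> : Pp^-1 = expR (- u) by rewrite expRN lnK.
  have -> : Pm^-1 = expR (- v) by rewrite expRN lnK.
  rewrite /weight /K.
  set a := - u + (- H (addt phi psi) + dot (addt h z) (addt phi psi)).
  set b := - v + (- H (addt phi (scalet (-1) psi)) +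
    dot (addt h (scalet (-1) z)) (addt phi (scalet (-1) psi))).
  rewrite -!expRD -/a -/b -mulrA -expRD.
  apply: (@le_trans _ _ (2 * expR ((a + b) / 2))).
    rewrite ler_pM2l// ler_expR /a /b !dotDl !dotDr !dotZl !dotZr.
    have := Hq phi psi; lra.
  have -> : (a + b) / 2 = a / 2 + b / 2 by lra.
  have Ea : expR a = expR (a / 2) ^+ 2 by rewrite -expRM_natl; congr expR; lra.
  have Eb : expR b = expR (b / 2) ^+ 2 by rewrite -expRM_natl; congr expR; lra.
  rewrite expRD Ea Eb -subr_ge0.
  have := sqr_ge0 (expR (a / 2) - expR (b / 2)); rewrite sqrrB; lra.
rewrite -mulrA (_ : 1 + 1 = 2 * 1) ?ler_pM2l//; last by lra.
have -> : Z h = expR (ln (Z h)) by rewrite lnK.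
rewrite /K -expRD -[leRHS]expR0 ler_expR expRK; lra.
Qed.

Variable K : n.-tuple TR -> n.-tuple TR.
Hypothesis KZ : forall a h, K (scalet a h) = scalet a (K h).
Hypothesis qZ : forall a psi, q (scalet a psi) = a ^+ 2 * q psi.

(** Half the gain [2 * dot z psi - q psi] of the midpoint bound at [psi = K z]. Every homogeneous
    [K] gives a valid bound; the choice of [K] is left open here. *)
Definition quad h := dot h (K h) - q (K h) / 2.

Lemma quadZ a h : quad (scalet a h) = a ^+ 2 * quad h.
Proof. rewrite /quad KZ dotZl dotZr qZ; ring. Qed.

(* The excess of ln Z over quad is midpoint convex; halving h repeatedly leaves
   only its linear part at 0. *)
Lemma lnZ_quad h :
  \sum_(i < n) (tnth h i : R) * M (scalet 0 h) i + quad h <=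
  ln (Z h) - ln (Z (scalet 0 h)).
Proof.
pose G s := ln (Z (scalet s h)).
have sc s t : addt (scalet s h) (scalet t h) = scalet (s + t) h.
  by apply: eq_from_tnth => i; rewrite !tnth_mktuple mulrDl.
have scN s : scalet (-1) (scalet s h) = scalet (- s) h.
  by apply: eq_from_tnth => i; rewrite !tnth_mktuple; lra.
have sc1 : scalet 1 h = h.
  by apply: eq_from_tnth => i; rewrite !tnth_mktuple mul1r.
(* In the midpoint bound both the field and the perturbation are [(s / 2) h], so the outer fields
   are [s h] and 0. *)
have step s : 2 * (G (s / 2) - G 0 - (s / 2) ^+ 2 * quad h) <=
  G s - G 0 - s ^+ 2 * quad h.
  have := lnZ_midpoint (scalet (s / 2) h) (scalet (s / 2) h) (K (scalet (s / 2) h)).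
  rewrite scN !sc subrr (_ : s / 2 + s / 2 = s); last by lra.
  rewrite -/(G s) -/(G 0) -/(G (s / 2)).
  have := quadZ (s / 2) h; rewrite /quad => E.
  rewrite /quad; lra.
have iter k : 2 ^+ k * (G (2 ^- k) - G 0 - (2 ^- k) ^+ 2 * quad h) <=
  G 1 - G 0 - quad h.
  elim: k => [|k IH]; first by rewrite expr0 invr1 expr1n !mul1r.
  apply: le_trans IH; have := step (2 ^- k).
  have -> : 2 ^- k / 2 = 2 ^- k.+1 :> R by rewrite exprS invfM mulrC.
  set w := 2 ^- k.+1.
  by rewrite (exprSr 2 k) -mulrA ler_pM2l ?exprn_gt0.
(* Jensen's inequality at the zero field bounds the difference quotient of [G] at 0 by the linear
   term; the quadratic error left over is of size [2 ^- k]. *)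
have lb k : \sum_(i < n) (tnth h i : R) * M (scalet 0 h) i - 2 ^- k * quad h <=
    G 1 - G 0 - quad h.
  apply: le_trans (iter k).
  have := lnZ_jensen (scalet 0 h) (scalet (2 ^- k) h).
  rewrite -/(G 0) -/(G (2 ^- k)).
  rewrite (_ : \sum_(i < n) _ = 2 ^- k * (\sum_(i < n) (tnth h i : R) * M (scalet 0
    h) i)); last first.
    by rewrite mulr_sumr; apply: eq_bigr => i _; rewrite !tnth_mktuple; ring.
  move: (\sum_(i < n) _) => S.
  have p0 : 0 < 2 ^+ k :> R by rewrite exprn_gt0.
  rewrite mulrC ler_pdivrMr// => A.
  have pn0 : 2 ^+ k != 0 :> R by rewrite gt_eqF.
  move: A p0 pn0; move: (2 ^+ k) (quad h) (G _) (G 0) => p Q g1 g0 A p0 pn0.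
  rewrite (_ : p * _ = (g1 - g0) * p - p^-1 * Q); last by field.
  by rewrite lerD2r.
rewrite addrC -lerBrDl.
have -> : ln (Z h) = G 1 by rewrite /G sc1.
rewrite -/(G 0).
apply/ler_addgt0Pr => e e0.
have [k ke] : exists k, `|quad h| < e * 2 ^+ k.
  exists (Num.truncn (`|quad h| / e)).+1.
  rewrite -ltr_pdivrMl// mulrC (lt_le_trans (truncnS_gt _))//.
  by rewrite -natrX ler_nat ltnW// ltn_expl.
have le_e : 2 ^- k * quad h <= e.
  rewrite mulrC ler_pdivrMr ?exprn_gt0//.
  by rewrite (le_trans (ler_norm _))// ltW.
have := lb k; move: le_e.
move: (2 ^- k * quad h) (\sum_(i < n) _) (quad h) (G 1) (G 0) => a b c u v.
lra.
Qed.

End quadratic_bound.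

Section reflection.
Local Open Scope ereal_scope.
Context {R : realType}.
Notation TR := (measurableTypeR R).

Lemma ge0_integral_lebesgueN (f : TR -> \bar R) :
  measurable_fun setT f -> (forall x, 0 <= f x) ->
  \int[lebesgue_measure]_x f (- x)%R = \int[lebesgue_measure]_x f x.
Proof.
move=> mf f0.
have mN : @measurable_fun _ _ TR TR setT (fun x : R => - x)%R.
  exact: measurableT_comp.
pose mN' := isMeasurableFun.Build _ _ _ _ _ mN.
pose g : {mfun TR >-> TR} := HB.pack (fun x : R => - x)%R mN'.
rewrite [RHS](eq_measure_integral (pushforward (@lebesgue_measure R) g)).
  by rewrite ge0_integral_pushforward.
by move=> A mA _; exact/esym/lebesgue_measureN.
Qed.

(** A vanishing integral would make [f] zero almost everywhere, hence the whole space a null set. *)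
Lemma integral_gt0 d (T : measurableType d) (m : {measure set T -> \bar R})
    (f : T -> \bar R) :
  0 < m setT -> measurable_fun setT f -> (forall x, 0 < f x) ->
  0 < \int[m]_x f x.
Proof.
move=> m0 mf f0; rewrite lt_neqAle integral_ge0 ?andbT; last first.
  by move=> x _; exact: ltW.
apply/negP => /eqP/esym I0.
have [+ _] := ae_eq_integral_abs m measurableT mf.
rewrite (eq_integral f) => [/(_ I0)|x _]; last by rewrite gee0_abs// ltW.
move=> [N [mN N0 sub]].
have NT : N = setT.
  apply/seteqP; split=> // x _; apply: sub => /= /(_ I).
  by move=> fx0; move: (f0 x); rewrite fx0 ltxx.
by move: m0; rewrite -NT N0 ltxx.
Qed.

Lemma pinning_measure_gt0 (eps : {nonneg R}) : 0 < pinning_measure eps setT.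
Proof.
rewrite /pinning_measure measure_addE.
apply: (@lt_le_trans _ _ (lebesgue_measure [set: R])).
  by rewrite -set_itvNyy lebesgue_measure_itv /= addye // ltry.
by apply: leeDl; exact: measure_ge0.
Qed.

Lemma power_integral_gt0 (eps : {nonneg R}) n (f : n.-tuple TR -> \bar R) :
  measurable_fun setT f -> (forall x, 0 < f x) ->
  0 < \int[power_measure (pinning_measure eps) n]_x f x.
Proof.
elim: n f => [|n IH] f mf f0.
  by rewrite /= integral_dirac// diracT mul1e.
have f0' x := ltW (f0 x).
rewrite integral_power_measureS//; apply: IH; first exact: measurable_inner_integral.
move=> t; apply: (@integral_gt0 _ TR (pinning_measure eps)) => //.
  exact: pinning_measure_gt0.
by apply: (measurableT_comp mf); exact: measurable_cons.
Qed.

End reflection.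

(** * Pinning cost and total mass of Gibbs weights *)

Section energy.
Context {R : realType} (n : nat).
Notation TR := (measurableTypeR R).
Variables (H : n.-tuple TR -> R) (q : n.-tuple TR -> R) (kappa : R).
Hypothesis mH : measurable_fun setT H.
Hypothesis Hq : forall phi psi,
  H (addt phi psi) + H (addt phi (scalet (-1) psi)) <= 2 * H phi + q psi.
Hypothesis qdelta : forall i s, q (deltat i s) <= kappa * s ^+ 2.
Hypothesis kappa0 : 0 <= kappa.

(* Averaging over s -> - s removes the linear term, so that only V'' <= 1 is used. *)
Lemma weight_sett_le h t i :
  ((weight H h (sett t i 0))%:E <=
   (expR (kappa / 2))%:E * \int[lebesgue_measure]_s (weight H h (sett t i s))%:E)%E.
Proof.
pose w s : R := weight H h (sett t i s).
have mw : @measurable_fun _ _ TR _ setT w.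
  apply: (measurableT_comp (measurable_weight mH h)); exact: measurable_sett.
have mwN : @measurable_fun _ _ TR _ setT (fun s : R => w (- s)).
  apply: (measurableT_comp mw); exact: measurable_funN.
have w0 s : 0 <= w s by rewrite ltW// weight_gt0.
have setE s : sett t i s = addt (sett t i 0) (deltat i s).
  apply: eq_from_tnth => j; rewrite !tnth_mktuple.
  by case: eqP => _; rewrite ?add0r ?addr0.
have scN s : scalet (-1) (deltat i s) = deltat i (- s) :> n.-tuple TR.
  apply: eq_from_tnth => j; rewrite !tnth_mktuple.
  by case: eqP => _; rewrite ?mulr0 ?mulN1r.
(* On [[0, 1]] the quadratic form is at most [kappa], and the interval has length 1, so the
   pointwise bound integrates without a further constant. *)
have key s : s \in `[0, 1] -> 2 * (w 0 * expR (- (kappa / 2))) <= w s + w (- s).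
  rewrite in_itv/= => /andP[s0 s1].
  rewrite /w (setE s) (setE (- s)) -scN /weight -expRD.
  set a := - H (addt _ (deltat i s)) + _.
  set b := - H (addt _ (scalet _ _)) + _.
  apply: (@le_trans _ _ (2 * expR ((a + b) / 2))).
    rewrite ler_pM2l// ler_expR /a /b !dotDr dotZr.
    have hq := Hq (sett t i 0) (deltat i s).
    have : q (deltat i s) <= kappa.
      apply: le_trans (qdelta i s) _; rewrite ler_piMr// expr_le1//.
    move: hq; move: (H _) (H _) (H _) (q _) (dot _ _) (dot _ _) => A B C D E F; lra.
  have -> : (a + b) / 2 = a / 2 + b / 2 by lra.
  have Ea : expR a = expR (a / 2) ^+ 2 by rewrite -expRM_natl; congr expR; lra.
  have Eb : expR b = expR (b / 2) ^+ 2 by rewrite -expRM_natl; congr expR; lra.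
  rewrite expRD Ea Eb -subr_ge0.
  have := sqr_ge0 (expR (a / 2) - expR (b / 2)); rewrite sqrrB.
  move: (expR _) (expR _) => A B; lra.
change ((w 0)%:E <= (expR (kappa / 2))%:E * \int[lebesgue_measure]_s (w s)%:E)%E.
clear setE scN; clearbody w.
have emw : @measurable_fun _ _ TR _ setT (fun s : R => (w s)%:E)
  by exact/measurable_EFinP.
have emwN : @measurable_fun _ _ TR _ setT (fun s : R => (w (- s))%:E)
  by exact/measurable_EFinP.
have ew0 s : (0 <= (w s)%:E)%E by rewrite lee_fin.
set I := (\int[_]_s _)%E.
have IN : (\int[lebesgue_measure]_s (w (- s))%:E = I)%E.
  exact: (ge0_integral_lebesgueN emw).
have : ((2 * (w 0 * expR (- (kappa / 2))))%:E <= I + I)%E.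
  rewrite -{2}IN -(ge0_integralD lebesgue_measure measurableT
    (fun x _ => ew0 x) emw (fun x _ => ew0 (- x)) emwN).
  pose D : set TR := `[0, 1]%classic.
  have mD : measurable D by exact: measurable_itv.
  have D1 : lebesgue_measure D = 1%E.
    by rewrite (lebesgue_measure_itv `[0, 1]) /= lte_fin ltr01 -EFinB subr0.
  have A : ((2 * (w 0 * expR (- (kappa / 2))))%:E <=
      \int[lebesgue_measure]_(s in D) (2 * (w 0 * expR (- (kappa / 2))))%:E)%E.
    rewrite (_ : (\int[_]_(s in D) _)%E = (2 * (w 0 * expR (- (kappa / 2))))%:E *
      lebesgue_measure D)%E; last exact: integral_cst.
    by rewrite D1 mule1.
  have B : (\int[lebesgue_measure]_(s in D) (2 * (w 0 * expR (- (kappa / 2))))%:E <=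
      \int[lebesgue_measure]_(s in D) ((w s)%:E + (w (- s))%:E))%E.
    apply: ge0_le_integral => //.
    - by move=> x _; rewrite lee_fin mulr_ge0// mulr_ge0// expR_ge0.
    - by apply: measurable_funTS; exact: emeasurable_funD.
  have C : (\int[lebesgue_measure]_(s in D) ((w s)%:E + (w (- s))%:E) <=
      \int[lebesgue_measure]_s ((w s)%:E + (w (- s))%:E))%E.
    apply: ge0_subset_integral => //; first exact: emeasurable_funD.
    by move=> x _; rewrite -EFinD lee_fin addr_ge0.
  exact: le_trans A (le_trans B C).
have I0 : (0 <= I)%E by apply: integral_ge0 => x _; rewrite lee_fin.
case: I I0 {IN} => [r|_ _|//]; last by rewrite gt0_muley ?leey// lte_fin expR_gt0.
rewrite -EFinD lee_fin => r0; rewrite -EFinM !lee_fin => hr.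
have {}hr : w 0 * expR (- (kappa / 2)) <= r by lra.
have E : w 0 = expR (kappa / 2) * (w 0 * expR (- (kappa / 2))).
  by rewrite mulrCA -expRD subrr expR0 mulr1.
by rewrite [leLHS]E ler_pM2l ?expR_gt0.
Qed.

Hypothesis coercive : forall M : R, exists C : R, forall phi : n.-tuple TR,
  M * \sum_(i < n) `|tnth phi i : R| - C <= H phi.

Lemma weight_lty0 h :
  (\int[power_measure (@pinning_measure R (0%:nng)%R) n]_phi (weight H h phi)%:E <
    +oo)%E.
Proof.
(* The slope exceeds the l1 norm of the field by 1: the surplus leaves [exp (- |phi_i|)] for each
   coordinate. *)
have [C HC] := coercive (1 + \sum_(i < n) `|tnth h i : R|).
pose g (t : n.-tuple TR) : R := expR C * \prod_(i < n) expR (- `|tnth t i : R|).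
have mN : measurable_fun [set: TR] (fun x : R => expR (- `|x|)).
  apply: (measurableT_comp (@measurable_expR R)).
  apply: measurableT_comp => //; exact: measurableT_comp.
have mprod : measurable_fun [set: n.-tuple TR]
    (fun t => (\prod_(i < n) expR (- `|tnth t i : R|))%:E).
  apply/measurable_EFinP; apply: measurable_prod => i _.
  apply: (measurableT_comp mN); exact: measurable_tnth.
have prod0 (t : n.-tuple TR) : (0 <= (\prod_(i < n) expR (- `|tnth t i : R|))%:E)%E.
  by rewrite lee_fin prodr_ge0// => i _; exact: expR_ge0.
apply: (@le_lt_trans _ _ (\int[power_measure (@pinning_measure R (0%:nng)%R) n]_t (g
  t)%:E)%E).
  apply: ge0_le_integral => //.
  - by move=> x _; rewrite lee_fin ltW// weight_gt0.
  - apply/measurable_EFinP; exact: measurable_weight.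
  - by apply/measurable_EFinP; apply: measurable_funM => //; exact/measurable_EFinP.
  move=> t _; rewrite lee_fin /g /weight -expR_sum -expRD ler_expR.
  have hC := HC t; rewrite sumrN.
  have : dot h t <= (\sum_(i < n) `|tnth h i : R|) * (\sum_(i < n) `|tnth t i : R|).
    rewrite /dot mulr_suml ler_sum// => i _.
    apply: (le_trans (ler_norm _)); rewrite normrM ler_wpM2l//.
    rewrite (bigD1 i)//= lerDl sumr_ge0//.
  move: hC; move: (\sum_(i < n) _) (\sum_(i < n) _) (H t) (dot h t) => a b c e; lra.
under eq_integral do rewrite /g EFinM.
rewrite (ge0_integralZl (power_measure _ n) measurableT mprod (fun t _ => prod0 t));
  last first.
  by rewrite lee_fin expR_ge0.
apply: lte_mul_pinfty; rewrite ?lee_fin ?expR_ge0//.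
apply: (@power_lebesgue_lty R n (fun x => expR (- `|x|))) => //.
exact: integral_expRN_lty.
Qed.

Lemma pinned_weight_le (eps : {nonneg R}) h :
  (\int[power_measure (pinning_measure eps) n]_phi (weight H h phi)%:E <=
   ((1 + eps%:num * expR (kappa / 2)) ^+ n)%:E *
   \int[power_measure (@pinning_measure R (0%:nng)%R) n]_phi (weight H h phi)%:E)%E.
Proof.
apply: pinning_power_le.
- exact: expR_ge0.
- apply/measurable_EFinP; exact: measurable_weight.
- by move=> t; rewrite lee_fin ltW// weight_gt0.
- by move=> t i; exact: weight_sett_le.
Qed.

Lemma weight_lty (eps : {nonneg R}) h :
  (\int[power_measure (pinning_measure eps) n]_phi (weight H h phi)%:E < +oo)%E.
Proof.
apply: (le_lt_trans (pinned_weight_le eps h)).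
apply: lte_mul_pinfty; [|by []|exact: weight_lty0].
by rewrite lee_fin exprn_ge0// addr_ge0// mulr_ge0// expR_ge0.
Qed.

Lemma weight_integral_gt0 (eps : {nonneg R}) h :
  (0 < \int[power_measure (pinning_measure eps) n]_phi (weight H h phi)%:E)%E.
Proof.
apply: power_integral_gt0; first by apply/measurable_EFinP; exact: measurable_weight.
by move=> t; rewrite lte_fin weight_gt0.
Qed.

End energy.

(** * The potential and the lattice energy *)

Section potential.
Context {R : realType} (V : R -> R).
Hypothesis V_derivable : forall t : R, derivable V t 1.

Lemma potential_continuous : continuous V.
Proof.
by move=> x; apply/differentiable_continuous; rewrite -derivable1_diffP.
Qed.

Hypothesis V_derivable2 : forall t : R, derivable (derive1 V) t 1.
Hypothesis V_second_derivative : forall t : R, derive1n 2 V t <= 1.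

Lemma derive1_potential_le a b : a <= b -> derive1 V b - derive1 V a <= b - a.
Proof.
rewrite le_eqVlt => /predU1P[->|ab]; first by rewrite !subrr.
have [||c _ ->] := @MVT R (derive1 V) (fun t => derive1n 2 V t) a b ab.
- move=> x _; have := derivableP (@V_derivable2 x); rewrite -derive1E; exact.
- by apply: derivable_within_continuous => x _; exact: V_derivable2.
by rewrite ler_piMl ?subr_ge0 ?(ltW ab)//; exact: V_second_derivative.
Qed.

(* V - t^2/2 is concave. *)
Lemma potential_midpoint x y : V (x + y) + V (x - y) <= 2 * V x + y ^+ 2.
Proof.
wlog y0 : y / 0 < y.
  move=> H; case: (ltrgt0P y) => [y0|y0|->]; first exact: H.
    have := H (- y); rewrite opprK sqrrN addrC; apply; lra.
  by rewrite addr0 subr0 expr2 mulr0; lra.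
pose U t := V t - t * t / 2.
have dU (t : R) : is_derive t 1 U (derive1 V t - t).
  have -> : U = V - (cst 2^-1 * (@id R * @id R)).
    apply/funext => s /=; rewrite /U; congr (_ - _).
    by rewrite [s * s / 2]mulrC.
  have h1 : is_derive t 1 V (derive1 V t).
    by have := derivableP (@V_derivable t); rewrite -derive1E; exact.
  have h2 : is_derive t 1 (@id R) 1 by exact: is_derive_id.
  have h3 : is_derive t 1 (cst (2^-1 : R)) 0 by exact: is_derive_cst.
  apply: (is_derive_eq (is_deriveB h1 (is_deriveM h3 (is_deriveM h2 h2)))).
  rewrite /GRing.scale /= !mulr1 mulr0 addr0.
  lra.
have cU (a b : R) : {within `[a, b], continuous U}.
  by apply: derivable_within_continuous => s _; have [] := dU s.
have [|c1] := @MVT R U (fun t => derive1 V t - t) x (x + y) _ (fun t _ => dU t) (cU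
  _ _).
  lra.
rewrite in_itv/= => /andP[c1l c1r] E1.
have [|c2] := @MVT R U (fun t => derive1 V t - t) (x - y) x _ (fun t _ => dU t) (cU
  _ _).
  lra.
rewrite in_itv/= => /andP[c2l c2r] E2.
have := @derive1_potential_le c2 c1; rewrite (ltW (lt_trans c2r c1l)) => /(_ isT) D.
have {}E1 : U (x + y) - U x = (derive1 V c1 - c1) * y by rewrite E1; congr (_ * _); lra.
have {}E2 : U x - U (x - y) = (derive1 V c2 - c2) * y by rewrite E2; congr (_ * _); lra.
have : (derive1 V c1 - c1) * y <= (derive1 V c2 - c2) * y by rewrite ler_pM2r//; lra.
rewrite -E1 -E2 /U; lra.
Qed.

Hypothesis V_growth : (1 < limf_einf (fun t : R => (ln (V t) / ln `|t|)%:E)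
                             (abs_pinfty R))%E.

Lemma potential_growth : exists b T : R, [/\ 1 < b, 1 < T &
  forall t, T < `|t| -> b * ln `|t| <= ln (V t)].
Proof.
move: V_growth; rewrite limf_einfE => /ereal_sup_gt[_ [A [M _ MA] <-]].
move=> inf1.
have [b b1 bA] : exists2 b : R, 1 < b & (b%:E <= ereal_inf
    ((fun t : R => (ln (V t) / ln `|t|)%:E) @` A))%E.
  move: inf1; case: (ereal_inf _) => [r| |//].
    rewrite lte_fin => r1; exists ((1 + r) / 2); first lra.
    by rewrite lee_fin; lra.
  by exists 2; [lra|rewrite leey].
(* The threshold 2 makes [ln |t|] positive, so that the bound on the quotient can be multiplied
   out. *)
exists b, (Num.max M 2); split=> //; first by rewrite lt_max; apply/orP; right; lra.
move=> t; rewrite gt_max => /andP[Mt t2].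
have : (b%:E <= (ln (V t) / ln `|t|)%:E)%E.
  apply: (le_trans bA); apply: ereal_inf_lbound; exists t => //.
  exact: MA.
by rewrite lee_fin ler_pdivlMr// ln_gt0//; lra.
Qed.

(** Far out, [V t] is at least [|t|] to a power [b > 1], which beats every slope; on the remaining
    compact interval [V] has a minimum. *)
Lemma potential_superlinear (M : R) : exists C : R, forall t, M * `|t| - C <= V t.
Proof.
have [b [T [b1 T1 HT]]] := potential_growth.
pose M' : R := `|M| + 1.
have M'1 : 1 <= M' by rewrite /M' lerDr.
(* Beyond this threshold [|t|] to the power [b - 1] is at least [M']. *)
pose T' : R := Num.max T (expR (ln M' / (b - 1))).
have T'0 : 0 <= T' by rewrite le_max (ltW (lt_trans ltr01 T1)).
have [c _ Vc] := @EVT_min R V (- T') T' (ge0_cp T'0).2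
  (continuous_subspaceT potential_continuous).
exists (Num.max 0 (`|M| * T' - V c)) => t.
case: (leP `|t| T') => tT'.
  have : V c <= V t by apply: Vc; rewrite in_itv/= -ler_norml.
  have : M * `|t| <= `|M| * T'.
    apply: (@le_trans _ _ (`|M| * `|t|)); first by rewrite ler_wpM2r// ler_norm.
    by rewrite ler_wpM2l.
  have : `|M| * T' - V c <= Num.max 0 (`|M| * T' - V c) by rewrite le_max lexx orbT.
  lra.
move: tT'; rewrite gt_max => /andP[tT tM].
have t0 : 0 < `|t| by lra.
have lnt0 : 0 < ln `|t| by rewrite ln_gt0//; lra.
have hlnV := HT _ tT.
have lnV0 : 0 < ln (V t).
  by apply: lt_le_trans hlnV; rewrite mulr_gt0//; lra.
(* The logarithm is 0 on nonpositive reals by convention, so a positive logarithm forces a positive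
   argument. *)
have V0 : 0 < V t.
  by rewrite ltNge; apply/negP => V0; move: lnV0; rewrite ln0// ltxx.
have hlnM : ln M' <= (b - 1) * ln `|t|.
  rewrite mulrC -ler_pdivrMr ?subr_gt0//.
  by rewrite -[leLHS]expRK ler_ln ?posrE ?expR_gt0// ltW.
have : M' * `|t| <= V t.
  rewrite -ler_ln ?posrE ?mulr_gt0//; last lra.
  rewrite lnM ?posrE//; last lra.
  have := hlnM; rewrite mulrBl mul1r; lra.
have : M * `|t| <= M' * `|t|.
  by rewrite ler_wpM2r// /M' (le_trans (ler_norm _))// lerDl.
have : 0 <= Num.max 0 (`|M| * T' - V c) by rewrite le_max lexx.
lra.
Qed.

End potential.

(** * The lattice energy and its Dirichlet form *)

Section lattice_energy.
Context {R : realType} {d : nat}.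
Variable Lambda : {fset site d}.
Notation TR := (measurableTypeR R).
Notation conf := (@config R d Lambda).
Implicit Types (phi psi : conf) (V : R -> R).

Definition energy V phi : R :=
  (4 * d)%:R^-1 * bulk_energy V phi + (4 * d)%:R^-1 * boundary_energy V phi.

Definition field (eta : site d -> R) : conf :=
  [tuple eta (fsval (enum_val k)) : TR | k < #|{: Lambda}|].

Lemma heightD phi psi i : height (addt phi psi) i = height phi i + height psi i.
Proof. by rewrite /height tnth_mktuple. Qed.

Lemma heightZ a phi i : height (scalet a phi) i = a * height phi i.
Proof. by rewrite /height tnth_mktuple. Qed.

Lemma height_field eta i : height (field eta) i = eta (fsval i).
Proof. by rewrite /height tnth_mktuple enum_rankK. Qed.

Lemma dot_height (h phi : conf) : dot h phi = \sum_(i : Lambda) height h i * height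
  phi i.
Proof.
rewrite /dot /height (reindex (@enum_rank Lambda))//=.
exists enum_val => x _; [exact: enum_rankK | exact: enum_valK].
Qed.

Lemma boltzmann_weightE V eta phi :
  boltzmann_weight V eta phi = weight (energy V) (field eta) phi.
Proof.
rewrite /boltzmann_weight /weight /energy opprD !mulNr; congr (expR (_ + _)).
by rewrite dot_height; apply: eq_bigr => i _; rewrite height_field.
Qed.

Lemma measurable_height i : measurable_fun setT (fun phi => height phi i).
Proof. exact: measurable_tnth. Qed.

Lemma measurable_sum_cond (I : Type) (s : seq I) (p : pred I) (F : I -> conf -> R) :
  (forall i, measurable_fun setT (F i)) ->
  measurable_fun setT (fun phi => \sum_(i <- s | p i) F i phi).
Proof.
move=> mF; rewrite (_ : (fun _ => _) =
  (fun phi => \sum_(i <- s) (if p i then F i phi else 0))).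
  by apply: measurable_sum => i; case: (p i).
by apply/funext => phi; rewrite big_mkcond.
Qed.

Lemma measurable_energy V : continuous V -> measurable_fun setT (energy V).
Proof.
move=> /continuous_measurable_fun mV.
apply: measurable_funD; apply: measurable_funM => //.
  apply: measurable_sum => i; apply: measurable_sum_cond => j.
  apply: (measurableT_comp mV); apply: measurable_funB; exact: measurable_height.
apply: measurable_sum => i; apply: measurable_sum_cond => j.
apply: (measurableT_comp mV); exact: measurable_height.
Qed.

(** The discrete Dirichlet form with zero boundary condition, normalised like the energy; it plays
    the role of [q]. *)
Definition sqenergy phi : R := energy (fun t => t ^+ 2) phi.

Lemma sqenergyZ a phi : sqenergy (scalet a phi) = a ^+ 2 * sqenergy phi.
Proof.
rewrite /sqenergy /energy mulrDr ![a ^+ 2 * (_ * _)]mulrCA.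
congr (_ * _ + _ * _); rewrite mulr_sumr; apply: eq_bigr => i _;
  rewrite mulr_sumr; apply: eq_bigr => j _; rewrite !heightZ -?mulrBr exprMn //.
Qed.

Lemma energy_midpoint V : (forall x y, V (x + y) + V (x - y) <= 2 * V x + y ^+ 2) ->
  forall phi psi, energy V (addt phi psi) + energy V (addt phi (scalet (-1) psi)) <=
    2 * energy V phi + sqenergy psi.
Proof.
move=> HV phi psi; rewrite /sqenergy /energy.
set c := _^-1; have c0 : 0 <= c by rewrite invr_ge0.
have B : bulk_energy V (addt phi psi) + bulk_energy V (addt phi (scalet (-1) psi)) <=
    2 * bulk_energy V phi + bulk_energy (fun t => t ^+ 2) psi.
  rewrite /bulk_energy mulr_sumr -!big_split/=; apply: ler_sum => i _.
  rewrite mulr_sumr -!big_split/=; apply: ler_sum => j _.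
  rewrite !heightD !heightZ.
  have := HV (height phi i - height phi j) (height psi i - height psi j).
  by congr (V _ + V _ <= _); ring.
have D : boundary_energy V (addt phi psi) + boundary_energy V (addt phi (scalet (-1)
  psi)) <=
    2 * boundary_energy V phi + boundary_energy (fun t => t ^+ 2) psi.
  rewrite /boundary_energy mulr_sumr -!big_split/=; apply: ler_sum => i _.
  rewrite mulr_sumr -!big_split/=; apply: ler_sum => j _.
  rewrite !heightD !heightZ mulN1r; exact: HV.
have := ler_wpM2l c0 B; have := ler_wpM2l c0 D; rewrite !mulrDr.
move: (bulk_energy _ _) (bulk_energy _ _) (bulk_energy _ _) (bulk_energy _ _)
  (boundary_energy _ _) (boundary_energy _ _) (boundary_energy _ _) (boundary_energy
    _ _).
move=> a1 a2 a3 a4 b1 b2 b3 b4; lra.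
Qed.

(** Extension by zero encodes the boundary condition: boundary terms become increments like the
    others, and sums can be translated over the whole lattice. *)
Definition zero_ext phi (x : site d) : R := if insub x is Some i then height phi i
  else 0.

Lemma zero_ext_in phi (i : Lambda) : zero_ext phi (fsval i) = height phi i.
Proof. by rewrite /zero_ext valK. Qed.

Lemma zero_ext_out phi x : x \notin Lambda -> zero_ext phi x = 0.
Proof. by move=> xL; rewrite /zero_ext insubN. Qed.

Lemma sum_fset_le_seq (s : seq (site d)) (F : site d -> R) :
  (forall x, 0 <= F x) ->
  \sum_(j : Lambda | fsval j \in s) F (fsval j) <= \sum_(x <- s | x \in Lambda) F x.
Proof.
move=> F0; elim: s => [|x s IH]; first by rewrite big_nil big1.
rewrite big_cons; case: ifPn => xL; last first.
  apply: le_trans IH; rewrite le_eqVlt; apply/orP; left; apply/eqP.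
  apply: eq_bigl => j; rewrite inE; case: eqP => // jx.
  by move: xL; rewrite -jx fsvalP.
apply: (@le_trans _ _ (F x + \sum_(j : Lambda | fsval j \in s) F (fsval j)));
  last first.
  by rewrite lerD2l.
pose i0 : Lambda := [` xL]%fset.
rewrite (bigD1 i0) /= ?mem_head// lerD2l.
rewrite [leLHS]big_mkcond [leRHS]big_mkcond/=; apply: ler_sum => j _.
rewrite inE; case: (eqVneq j i0) => [->|ji0]; first by rewrite andbF; case: ifP.
have -> : (fsval j == x) = false.
  by apply: contraNF ji0 => /eqP jx; apply/eqP/val_inj.
by rewrite andbT.
Qed.

(** Boundary edges agree on both sides. An edge inside [Lambda] is counted once in the energy, from
    its lower end, but from both ends on the right, hence the inequality. *)
Lemma sqenergy_le_gradient phi :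
  sqenergy phi <= (4 * d)%:R^-1 *
    \sum_(i : Lambda) \sum_(y <- neighbours (fsval i)) (zero_ext phi (fsval i) -
      zero_ext phi y) ^+ 2.
Proof.
rewrite /sqenergy /energy -mulrDr ler_wpM2l ?invr_ge0//.
rewrite /bulk_energy /boundary_energy -big_split/=; apply: ler_sum => i _.
rewrite [leRHS](bigID [in Lambda])/=; apply: lerD; last first.
  rewrite le_eqVlt; apply/orP; left; apply/eqP; apply: eq_bigr => y yL.
  by rewrite zero_ext_in (zero_ext_out _ yL) subr0.
apply: (@le_trans _ _ (\sum_(y <- up_neighbours (fsval i) | y \in Lambda)
    (zero_ext phi (fsval i) - zero_ext phi y) ^+ 2)).
  apply: le_trans (sum_fset_le_seq _ _); last by move=> x; exact: sqr_ge0.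
  rewrite le_eqVlt; apply/orP; left; apply/eqP; apply: eq_bigr => j _.
  by rewrite !zero_ext_in.
rewrite /neighbours big_cat/= lerDl sumr_ge0// => y _; exact: sqr_ge0.
Qed.

Lemma sum_neighbours (F : site d -> R) (x : site d) :
  \sum_(y <- neighbours x) F y =
  \sum_(k < d) (F (x + delta_mx 0 k) + F (x - delta_mx 0 k)).
Proof. by rewrite /neighbours big_cat/= !big_image/= -big_split. Qed.

Lemma ler_sum_uniq (T : eqType) (s t : seq T) (F : T -> R) :
  uniq s -> uniq t -> (forall x, 0 <= F x) -> (forall x, x \notin t -> F x = 0) ->
  \sum_(x <- s) F x <= \sum_(x <- t) F x.
Proof.
move=> us ut F0 Ft.
rewrite (bigID [in t])/= [X in _ + X]big1 ?addr0//.
rewrite -big_filter (perm_big [seq x <- t | x \in s])/=; last first.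
  by apply: uniq_perm; rewrite ?filter_uniq// => x; rewrite !mem_filter andbC.
rewrite big_filter [leRHS](bigID [in s])/= lerDl sumr_ge0// => x _; exact: F0.
Qed.

Lemma sum_shift_le (F : site d -> R) (v : site d) (t : seq (site d)) :
  uniq t -> (forall x, 0 <= F x) -> (forall x, x \notin t -> F x = 0) ->
  \sum_(i : Lambda) F (fsval i + v) <= \sum_(x <- t) F x.
Proof.
move=> ut F0 Ft.
have U : uniq [seq fsval i + v | i <- enum {: Lambda}].
  rewrite map_inj_uniq ?enum_uniq// => i j /addIr; exact: val_inj.
have := ler_sum_uniq U ut F0 Ft; rewrite big_map big_enum; exact: le_trans.
Qed.

(** From [(x - y)^2 <= 2 (x^2 + y^2)], each of the [d] directions contributes at most [8 s^2], and
    [8 d / (4 d) = 2]. A crude constant suffices, as it enters only the cost of pinning. *)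
Lemma sqenergy_deltat (k : 'I_#|{: Lambda}|) (s : R) :
  (0 < d)%N -> sqenergy (deltat k s) <= 2 * s ^+ 2.
Proof.
move=> d0; apply: (le_trans (sqenergy_le_gradient _)).
pose F x := zero_ext (deltat k s) x ^+ 2.
pose x0 := fsval (enum_val k).
have F0 x : 0 <= F x by exact: sqr_ge0.
have Fx0 : F x0 = s ^+ 2.
  by rewrite /F zero_ext_in /height tnth_mktuple enum_valK eqxx.
have Fx x : x \notin [:: x0] -> F x = 0.
  rewrite inE => xx0; rewrite /F; case: (boolP (x \in Lambda)) => xL; last first.
    by rewrite zero_ext_out// expr2 mulr0.
  have -> : x = fsval ([` xL]%fset : Lambda) by [].
  rewrite zero_ext_in /height tnth_mktuple; case: eqP => [E|_]; last
    by rewrite expr2 mulr0.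
  by move: xx0; rewrite /x0 -E enum_rankK eqxx.
have shift v : \sum_(i : Lambda) F (fsval i + v) <= s ^+ 2.
  by rewrite -Fx0 -(big_seq1 +%R x0 F); exact: sum_shift_le.
rewrite ler_pdivrMl ?ltr0n ?muln_gt0//.
apply: (@le_trans _ _ (\sum_(i : Lambda) \sum_(k < d)
   (2 * (F (fsval i + 0) + F (fsval i + delta_mx 0 k)) +
    2 * (F (fsval i + 0) + F (fsval i - delta_mx 0 k))))).
  apply: ler_sum => i _; rewrite sum_neighbours; apply: ler_sum => l _.
  rewrite addr0 /F; move: (zero_ext _ _) (zero_ext _ _) (zero_ext _ _) => a b c.
  have sq (x y : R) : (x - y) ^+ 2 <= 2 * (x ^+ 2 + y ^+ 2).
    by have := sqr_ge0 (x + y); rewrite sqrrB sqrrD; lra.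
  exact: lerD.
rewrite exchange_big/=.
apply: (@le_trans _ _ (\sum_(l < d) (8 * s ^+ 2))).
  apply: ler_sum => l _; rewrite big_split/= -!mulr_sumr !big_split/=.
  have := shift 0; have := shift (delta_mx 0 l); have := shift (- delta_mx 0 l).
  move: (\sum_(i : Lambda) _) (\sum_(i : Lambda) _) (\sum_(i : Lambda) _) => a b c; lra.
by rewrite sumr_const card_ord -mulr_natr natrM; lra.
Qed.

End lattice_energy.

(** * Coercivity of the energy in a box *)

Section coercivity.
Context {R : realType}.
Variable L : nat.
Notation TR := (measurableTypeR R).
Notation conf := (@config R 2 (box 2 L)).

(** Walking from a site in the first coordinate direction, one leaves the box after at most
    [2 L + 1] steps. Each increment, and the last height before leaving, is bounded by the total
    variation [S], so [S] controls every height. *)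
Lemma energy_coercive (V : R -> R) :
  (forall M : R, exists C : R, forall t, M * `|t| - C <= V t) ->
  forall M : R, exists C : R, forall phi : conf,
    M * \sum_(i < #|{: box 2 L}|) `|tnth phi i : R| - C <= energy V phi.
Proof.
move=> HV M.
pose S (phi : conf) : R := bulk_energy Num.norm phi + boundary_energy Num.norm phi.
have path (phi : conf) m (i : box 2 L) : L%:Z - fsval i 0 0 < m%:Z ->
    `|height phi i| <= m%:R * S phi.
  have bulk0 : 0 <= bulk_energy Num.norm phi.
    by apply: sumr_ge0 => x _; apply: sumr_ge0 => y _.
  have bdry0 : 0 <= boundary_energy Num.norm phi.
    by apply: sumr_ge0 => x _; apply: sumr_ge0 => y _.
  elim: m i => [|m IH] i.
    have := fsvalP i; rewrite mem_box => /forallP/(_ 0);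
      rewrite ler_norml => /andP[_ h].
    by rewrite ltNge subr_ge0 h.
  move=> im; rewrite -natr1 mulrDl mul1r.
  pose y : site 2 := fsval i + delta_mx 0 0.
  have yup : y \in up_neighbours (fsval i) by apply/mapP; exists 0; rewrite ?mem_enum.
  case: (boolP (y \in box 2 L)) => yL.
    pose j : box 2 L := [` yL]%fset.
    have hj : `|height phi j| <= m%:R * S phi.
      apply: IH => /=; move: im; rewrite -(addn1 m) PoszD !mxE eqxx/=.
      by move=> h; rewrite opprD addrA ltrBlDr; exact: h.
    have hij : `|height phi i - height phi j| <= S phi.
      apply: (@le_trans _ _ (bulk_energy Num.norm phi)); last by rewrite lerDl.
      rewrite /bulk_energy (bigD1 i)//= (bigD1 j)//= -addrA lerDl addr_ge0//.
        by apply: sumr_ge0.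
      by apply: sumr_ge0 => x _; apply: sumr_ge0 => z _.
    have := ler_normD (height phi i - height phi j) (height phi j).
    rewrite subrK => /le_trans; apply.
    by rewrite addrC lerD.
  have hi : `|height phi i| <= S phi.
    apply: (@le_trans _ _ (boundary_energy Num.norm phi)); last by rewrite lerDr.
    rewrite /boundary_energy (bigD1 i)//=.
    have yn : y \in neighbours (fsval i) by rewrite mem_cat yup.
    rewrite (big_rem y)//= yL -addrA lerDl addr_ge0//.
      by apply: sumr_ge0.
    by apply: sumr_ge0 => x _; apply: sumr_ge0 => z _.
  by apply: (le_trans hi); rewrite lerDr mulr_ge0// addr_ge0.
pose N := #|{: box 2 L}|.
have Sge (phi : conf) : \sum_(i < N) `|tnth phi i : R| <= (N * L.*2.+1)%:R * S phi.
  apply: (@le_trans _ _ (\sum_(i < N) (L.*2.+1)%:R * S phi)); last first.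
    by rewrite sumr_const card_ord natrM -mulrA [leRHS]mulr_natl.
  apply: ler_sum => i _; have := path phi L.*2.+1 (enum_val i).
  rewrite /height enum_valK; apply.
  have := fsvalP (enum_val i); rewrite mem_box => /forallP/(_ 0);
    rewrite ler_norml => /andP[h _].
  move: h; rewrite -addnn -(addn1 (L + L)%N) !PoszD;
    move: (fsval (enum_val i) 0 0) => c h.
  by rewrite ltzD1 lerD2l lerNl.
(* The 8 undoes the prefactor [1 / (4 d)]; the rest is the constant relating the l1 norm of the
   heights to [S]. *)
pose K : R := `|M| * 8 * (N * L.*2.+1)%:R.
have [C HC] := HV K.
(* The affine lower bound on [V] loses [C] per edge; these terms are [C] times the numbers of bulk
   and boundary edges, the same for every configuration. *)
pose cst1 (phi : conf) : R := bulk_energy (fun=> C) phi.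
pose cst2 (phi : conf) : R := boundary_energy (fun=> C) phi.
exists (8^-1 * cst1 [tuple 0 : TR | k < N] + 8^-1 * cst2 [tuple 0 : TR | k < N]) => phi.
have B : K * bulk_energy Num.norm phi - cst1 [tuple 0 : TR | k < N] <=
  bulk_energy V phi.
  rewrite /bulk_energy /cst1 /bulk_energy mulr_sumr -sumrB; apply: ler_sum => i _.
  by rewrite mulr_sumr -sumrB; apply: ler_sum => j _.
have D : K * boundary_energy Num.norm phi - cst2 [tuple 0 : TR | k < N] <=
  boundary_energy V phi.
  rewrite /boundary_energy /cst2 /boundary_energy mulr_sumr -sumrB;
    apply: ler_sum => i _.
  by rewrite mulr_sumr -sumrB; apply: ler_sum => j _.
rewrite /energy (_ : (4 * 2)%:R = 8 :> R)//.
have : M * \sum_(i < N) `|tnth phi i : R| <= 8^-1 * (K * S phi).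
  apply: (@le_trans _ _ (`|M| * \sum_(i < N) `|tnth phi i : R|)).
    by rewrite ler_wpM2r ?ler_norm// sumr_ge0.
  rewrite /K (_ : 8^-1 * _ = `|M| * ((N * L.*2.+1)%:R * S phi)); last by field.
  by rewrite ler_wpM2l.
rewrite /S mulrDr; move: B D.
move: (bulk_energy _ _) (bulk_energy _ _) (boundary_energy _ _) (boundary_energy _
  _) (cst1 _) (cst2 _) (\sum_(i < N) _).
move=> *; lra.
Qed.

End coercivity.

(** * The logarithmic test profile *)

Section log_profile.
Context {R : realType}.
Notation TR := (measurableTypeR R).

Definition harm (r : nat) : R := \sum_(0 <= a < r) a.+1%:R^-1.

Definition tail_harm (r s : nat) : R := \sum_(s <= a < r) a.+1%:R^-1.

Lemma harmS r : harm r.+1 = harm r + r.+1%:R^-1.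
Proof. by rewrite /harm big_nat_recr. Qed.

Lemma harm_ge0 r : 0 <= harm r.
Proof. by apply: sumr_ge0 => a _; rewrite invr_ge0. Qed.

Lemma ln_le_harm r : ln (r.+1%:R : R) <= harm r.
Proof.
elim: r => [|r IH]; first by rewrite ln1 /harm big_geq.
have r0 : 0 < r.+1%:R :> R by rewrite ltr0n.
rewrite harmS (_ : r.+2%:R = r.+1%:R * (1 + r.+1%:R^-1) :> R); last first.
  by rewrite mulrDr mulr1 divff ?gt_eqF// natr1.
have i0 : 0 < r.+1%:R^-1 :> R by rewrite invr_gt0.
rewrite lnM; [|by rewrite posrE|by rewrite posrE addr_gt0].
by rewrite lerD// le_ln1Dx// (lt_trans _ i0)// ltrN10.
Qed.

Lemma harmS_le2 r : (0 < r)%N -> harm r.+1 <= 2 * harm r.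
Proof.
move=> r0; rewrite harmS mulrDl mul1r lerD2l.
case: r r0 => // r _; rewrite harmS -[leLHS]add0r lerD ?harm_ge0//.
by rewrite lef_pV2 ?posrE ?ltr0n// ler_nat.
Qed.

(** Enlarging the square adds [2 r + 1] cells with summand [1 / (r + 1)^2], in total less than
    [2 / (r + 1)]. This two-dimensional count makes the energy logarithmic. *)
Lemma sum_inv_max_sq r :
  \sum_(0 <= a < r) \sum_(0 <= b < r) ((maxn a b).+1%:R ^+ 2)^-1 <= 2 * harm r :> R.
Proof.
elim: r => [|r IH]; first by rewrite big_geq// mulr_ge0// harm_ge0.
rewrite harmS big_nat_recr//= big_nat_recr//=.
under eq_bigr do rewrite big_nat_recr//=.
rewrite big_split/= maxnn.
set p : R := r.+1%:R.
have p0 : 0 < p by rewrite ltr0n.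
have -> : \sum_(0 <= i < r) ((maxn i r).+1%:R ^+ 2)^-1 = r%:R * (p ^+ 2)^-1 :> R.
  rewrite (eq_big_nat _ _ (F2 := fun=> (p ^+ 2)^-1)); last first.
    by move=> i /andP[_ ir]; rewrite (maxn_idPr (ltnW ir)).
  by rewrite big_const_nat subn0 iter_addr_0 mulr_natl.
have -> : \sum_(0 <= i < r) ((maxn r i).+1%:R ^+ 2)^-1 = r%:R * (p ^+ 2)^-1 :> R.
  rewrite (eq_big_nat _ _ (F2 := fun=> (p ^+ 2)^-1)); last first.
    by move=> i /andP[_ ir]; rewrite (maxn_idPl (ltnW ir)).
  by rewrite big_const_nat subn0 iter_addr_0 mulr_natl.
rewrite mulrDr -addrA lerD//.
have -> : r%:R = p - 1 :> R by rewrite /p -natr1 addrK.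
have q0 : 0 <= (p ^+ 2)^-1 by rewrite invr_ge0 exprn_ge0// ltW.
have -> : 2 * p^-1 = 2 * p * (p ^+ 2)^-1 by field; rewrite gt_eqF.
move: (p ^+ 2)^-1 q0 => q q0.
rewrite (_ : _ + _ = (2 * p - 1) * q); last by ring.
by rewrite ler_wpM2r//; lra.
Qed.

Definition snorm (x : site 2) : nat := maxn `|(x 0 0)%R|%N `|(x 0 1)%R|%N.

Lemma snormD (x v : site 2) (m : nat) : (snorm v <= m)%N ->
  (snorm (x + v)%R <= snorm x + m)%N.
Proof.
rewrite /snorm !mxE; move: (x 0 0) (x 0 1) (v 0 0) (v 0 1) => a b c e; lia.
Qed.

Lemma snormN (x : site 2) : snorm (- x) = snorm x.
Proof. by rewrite /snorm !mxE !abszN. Qed.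

Lemma snorm_delta k : (snorm (delta_mx 0%R k) <= 1)%N.
Proof. by rewrite /snorm !mxE eqxx/=; do 2 case: eqP. Qed.

(** A discrete [ln (r / |x|)] in the sup norm, zero from radius [r] on; its value at the origin is
    the full harmonic sum. *)
Definition profile (r : nat) (x : site 2) : R := tail_harm r (snorm x).

Lemma profile_out r x : (r <= snorm x)%N -> profile r x = 0.
Proof. by move=> rx; rewrite /profile /tail_harm big_geq. Qed.

Lemma profile0 r : profile r 0 = harm r.
Proof. by rewrite /profile /snorm !mxE. Qed.

(** A bound on the squared increment to any neighbour. The increment inwards from norm [s] is
    [1 / s <= 2 / (s + 1)], hence the factor 4. Norm exactly [r] is included, since the neighbour
    inside may carry a nonzero value. *)
Definition profile_slope (r : nat) (x : site 2) : R :=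
  if (snorm x <= r)%N then 4 * ((snorm x).+1%:R ^+ 2)^-1 else 0.

Lemma profile_slope_ge0 r x : 0 <= profile_slope r x.
Proof. by rewrite /profile_slope; case: ifP => // _;
  rewrite mulr_ge0// invr_ge0 exprn_ge0. Qed.

Lemma tail_harmS r s : tail_harm r s - tail_harm r s.+1 =
  if (s < r)%N then s.+1%:R^-1 else 0.
Proof.
rewrite /tail_harm; case: ifP => [sr|/negbT]; first by rewrite big_ltn// addrK.
by rewrite -leqNgt => rs; rewrite !big_geq ?subr0// leqW.
Qed.

Lemma profile_sq_diff r (x y : site 2) : (snorm y <= (snorm x).+1)%N ->
  (snorm x <= (snorm y).+1)%N -> (profile r x - profile r y) ^+ 2 <= profile_slope r x.
Proof.
rewrite /profile /profile_slope; move: (snorm x) (snorm y) => s t ts st.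
have pos (u : nat) : 0 < u.+1%:R :> R by rewrite ltr0n.
have slope_ge0 (c : bool) : 0 <= (if c then 4 * (s.+1%:R ^+ 2)^-1 else 0) :> R.
  by case: c => //; rewrite mulr_ge0// invr_ge0 exprn_ge0.
case: (ltngtP s t) => [slt|tls|<-].
- have {}ts : t = s.+1 by apply/eqP; rewrite eqn_leq ts.
  rewrite ts tail_harmS; case: ifP => [sr|_]; last by rewrite expr0n.
  by rewrite (ltnW sr) exprVn ler_peMl ?invr_ge0 ?exprn_ge0//; lra.
- have {}st : s = t.+1 by apply/eqP; rewrite eqn_leq st.
  rewrite -sqrrN opprB [X in tail_harm r t - tail_harm r X]st tail_harmS st.
  case: ifP => _; last by rewrite expr0n.
  rewrite exprVn.
  have -> : 4 * (t.+2%:R ^+ 2)^-1 = ((t.+2%:R / 2) ^+ 2)^-1 :> R.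
    by rewrite expr_div_n invf_div; congr (_ / _); rewrite -natrX.
  rewrite lef_pV2 ?posrE ?exprn_gt0 ?divr_gt0//.
  rewrite ler_sqr ?nnegrE ?divr_ge0 ?ler0n// ler_pdivrMr//.
  by rewrite -natrM ler_nat; lia.
- by rewrite subrr expr0n.
Qed.

(** The range runs from [- r] to [r - 1]: both halves then have the same length, and the extra point
    [- r] is harmless for summands vanishing from [r] on. *)
Definition int_ball (r : nat) : seq int :=
  [seq n%:Z | n <- index_iota 0 r] ++ [seq - n.+1%:Z | n <- index_iota 0 r].

Lemma int_ball_uniq r : uniq (int_ball r).
Proof.
rewrite cat_uniq !map_inj_uniq ?iota_uniq//=; last 2 first.
- by move=> a b /oppr_inj[].
- by move=> a b [].
rewrite andbT; apply/hasPn => _ /mapP[a _ ->]; apply/negP => /mapP[b _].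
lia.
Qed.

Lemma mem_int_ball r (z : int) : (`|z| < r)%N -> z \in int_ball r.
Proof.
move=> zr; rewrite mem_cat; case: (lerP 0 z) => z0.
  apply/orP; left; apply/mapP; exists `|z|%N; first by rewrite mem_index_iota.
  lia.
apply/orP; right; apply/mapP; exists `|z|.-1%N; last lia.
rewrite mem_index_iota; lia.
Qed.

Lemma sum_int_ball r (F : nat -> R) : (forall a, 0 <= F a) ->
  (forall a, (r <= a)%N -> F a = 0) ->
  \sum_(z <- int_ball r) F `|z|%N <= 2 * \sum_(0 <= a < r) F a.
Proof.
move=> F0 Fr; rewrite big_cat !big_map/= mulrDl mul1r lerD2l.
case: r Fr => [|r] Fr; first by rewrite !big_geq.
rewrite big_nat_recr//= Fr// addr0 [leRHS]big_nat_recl//=.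
by rewrite lerDr.
Qed.

Definition mksite (a b : int) : site 2 := \row_(k < 2) (if k == 0 then a else b).

Lemma mksiteE (x : site 2) : x = mksite (x 0 0) (x 0 1).
Proof.
apply/rowP => k; rewrite mxE; case: eqP => [->//|k0].
by congr (x _ _); apply/val_inj; case: k k0 => [[|[|]]]//= ? k0; case: k0;
  exact/val_inj.
Qed.

(** The constant is [4 * 4 * 2 * 2]: the slope factor, the signs of the two coordinates, the sum
    over the quadrant, and the passage from [harm r.+1] to [harm r]. *)
Lemma profile_slope_sum (Lambda : {fset site 2}) r (v : site 2) : (0 < r)%N ->
  \sum_(i : Lambda) profile_slope r (fsval i + v) <= 64 * harm r.
Proof.
move=> r0.
pose t := [seq mksite a b | a <- int_ball r.+1, b <- int_ball r.+1].
have ut : uniq t.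
  apply: allpairs_uniq; try exact: int_ball_uniq.
  move=> [a b] [a' b'] _ _ /= /rowP E.
  by have := E 0; have := E 1; rewrite !mxE/= => -> ->.
apply: (@le_trans _ _ (\sum_(x <- t) profile_slope r x)).
  apply: sum_shift_le => //; first exact: profile_slope_ge0.
  move=> x; rewrite /profile_slope; case: ifP => // xr; apply: contraNeq => _.
  rewrite (mksiteE x); apply/allpairsP; exists (x 0 0, x 0 1); split => //=;
    apply: mem_int_ball; move: xr; rewrite /snorm; lia.
rewrite /t big_allpairs_dep /=.
pose G (a b : nat) : R := if (maxn a b <= r)%N then 4 * ((maxn a b).+1%:R ^+ 2)^-1
  else 0.
have G0 a b : 0 <= G a b.
  by rewrite /G; case: ifP => // _; rewrite mulr_ge0// invr_ge0 exprn_ge0.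
have Gr a b : (r < maxn a b)%N -> G a b = 0 by rewrite /G ltnNge => /negbTE ->.
have -> : \sum_(a <- int_ball r.+1) \sum_(b <- int_ball r.+1) profile_slope r
  (mksite a b) =
    \sum_(a <- int_ball r.+1) \sum_(b <- int_ball r.+1) G `|a|%N `|b|%N.
  by apply: eq_bigr => a _; apply: eq_bigr => b _;
    rewrite /profile_slope /G /snorm !mxE.
apply: (@le_trans _ _ (\sum_(a <- int_ball r.+1) (2 * \sum_(0 <=
  b < r.+1) G `|a|%N b))).
  apply: ler_sum => a _; apply: (@sum_int_ball _ (G `|a|%N)) => // b rb.
  by apply: Gr; rewrite (leq_trans rb)// leq_maxr.
apply: (@le_trans _ _ (2 * \sum_(0 <= a < r.+1) (2 * \sum_(0 <= b < r.+1) G a b))).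
  apply: (@sum_int_ball _ (fun a => 2 * \sum_(0 <= b < r.+1) G a b)) => [a|a ra].
    by rewrite mulr_ge0// sumr_ge0.
  rewrite big1 ?mulr0// => b _.
  by apply: Gr; rewrite (leq_trans ra)// leq_maxl.
rewrite -mulr_sumr.
have -> : \sum_(0 <= a < r.+1) \sum_(0 <= b < r.+1) G a b =
    4 * \sum_(0 <= a < r.+1) \sum_(0 <= b < r.+1) ((maxn a b).+1%:R ^+ 2)^-1.
  rewrite mulr_sumr; apply: eq_big_nat => a /andP[_ ar]; rewrite mulr_sumr.
  apply: eq_big_nat => b /andP[_ br]; rewrite /G ifT//; lia.
have := sum_inv_max_sq r.+1; have := harmS_le2 r0.
move: (harm _) (harm _) (\sum_(0 <= a < r.+1) _) => A B C; lra.
Qed.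

Lemma box_snorm L (x : site 2) : (x \in box 2 L) = (snorm x <= L)%N.
Proof.
have e k : (`|x 0 k| <= L%:Z) = (`|(x 0 k)%R| <= L)%N by rewrite -lez_nat abszE.
rewrite mem_box /snorm geq_max; apply/forallP/andP => [h|[h0 h1] k].
  by rewrite -!e.
by rewrite (mksiteE x) mxE; case: ifP => _; rewrite e.
Qed.

Definition profile_config L M (k : site 2) : @config R 2 (box 2 L) :=
  [tuple profile M (fsval (enum_val i) - k) : TR | i < #|{: box 2 L}|].

(** A profile of radius [M] centred in the box of size [M] vanishes outside the box of size [L], so
    cutting it to that box creates no boundary jump. Four neighbours and the prefactor [1 / 8] turn
    64 into 32. *)
Lemma sqenergy_profile L M (k : site 2) : k \in box 2 M -> (M + M <= L)%N ->
  (0 < M)%N -> sqenergy (profile_config L M k) <= 32 * harm M.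
Proof.
rewrite box_snorm => kM ML M0.
have extE y : zero_ext (profile_config L M k) y = profile M (y - k).
  case: (boolP (y \in box 2 L)) => yL.
    have -> : y = fsval ([` yL]%fset : box 2 L) by [].
    by rewrite zero_ext_in /height tnth_mktuple enum_rankK.
  rewrite zero_ext_out// profile_out//; move: yL; rewrite box_snorm -ltnNge => yL.
  have := @snormD (y - k) k M kM; rewrite subrK => h; lia.
apply: (le_trans (sqenergy_le_gradient _)).
rewrite ler_pdivrMl ?ltr0n//.
apply: (@le_trans _ _ (\sum_(i : box 2 L) 4 * profile_slope M (fsval i + - k)));
  last first.
  rewrite -mulr_sumr; have := profile_slope_sum (box 2 L) (- k) M0.
  move: (\sum_(i : _) _) (harm M) => a b; rewrite (_ : (4 * 2)%:R = 8 :> R)//; lra.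
apply: ler_sum => i _; rewrite sum_neighbours !extE.
under eq_bigr do rewrite !extE.
have le1 v : (snorm v <= 1)%N ->
    (profile M (fsval i - k) - profile M (fsval i + v - k)) ^+ 2 <=
    profile_slope M (fsval i - k).
  move=> v1; apply: profile_sq_diff; rewrite addrAC.
    by have := snormD (fsval i - k) v1; rewrite addn1.
  have v1' : (snorm (- v) <= 1)%N by rewrite snormN.
  by have := snormD (fsval i - k + v) v1'; rewrite addrK addn1.
rewrite big_ord_recl big_ord1 /=.
have := le1 (delta_mx 0 0) (snorm_delta _).
have := le1 (delta_mx 0 (lift ord0 ord0)) (snorm_delta _).
have := le1 (- delta_mx 0 0); rewrite snormN => /(_ (snorm_delta _)).
have := le1 (- delta_mx 0 (lift ord0 ord0)); rewrite snormN => /(_ (snorm_delta _)).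
move: (profile_slope _ _) ((_ - _) ^+ 2) ((_ - _) ^+ 2) ((_ - _) ^+ 2) ((_ - _) ^+ 2).
move=> a b c e f; lra.
Qed.

End log_profile.

(** * Independent symmetric fields *)

Section tuple_law.
Context d (T : measurableType d) (R : realType) (n : nat).
Notation TR := (measurableTypeR R).
Implicit Types A : 'I_n -> set TR.

Definition rectangle A : set (n.-tuple TR) := [set t | forall k, A k (tnth t k)].

Definition rectangles : set (set (n.-tuple TR)) :=
  [set rectangle A | A in [set A | forall k, measurable (A k)]].

Lemma measurable_rectangle A : (forall k, measurable (A k)) -> measurable (rectangle A).
Proof.
move=> mA.
have -> : rectangle A = \bigcap_(k in [set: 'I_n]) ((fun t => tnth t k) @^-1` A k).
  by apply/seteqP; split=> [t h k _|t h k]; [exact: h|exact: (h k I)].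
apply: fin_bigcap_measurable => [|k _]; first exact: finite_finset.
rewrite -[X in measurable X]setTI; exact: (@measurable_tnth _ TR n k measurableT).
Qed.

Lemma tuple_measurable_rectangles :
  @measurable _ (n.-tuple TR) = <<s rectangles >>.
Proof.
apply/seteqP; split.
- apply: smallest_sub; first exact: smallest_sigma_algebra.
  move=> B; rewrite -bigcup_seq => -[k _ [C mC <-]].
  apply: sub_sigma_algebra.
  exists (fun j => if j == k then C else setT).
    by move=> j /=; case: ifP.
  rewrite setTI; apply/seteqP; split=> t /=.
    by move=> /(_ k); rewrite eqxx.
  by move=> h j; case: eqP => // ->.
- apply: smallest_sub; first exact: sigma_algebra_measurable.
  move=> _ [A mA <-]; exact: measurable_rectangle.
Qed.

(** The rectangles contain the whole space, are stable under intersection and generate the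
    sigma-algebra of tuples. *)
Lemma tuple_law_unique (m1 m2 : probability (n.-tuple TR) R) :
  (forall A, (forall k, measurable (A k)) -> m1 (rectangle A) = m2 (rectangle A)) ->
  forall B, measurable B -> m1 B = m2 B.
Proof.
move=> m12.
have rT : rectangles setT.
  by exists (fun=> setT) => //; apply/seteqP; split.
apply: (measure_unique rectangles (fun=> setT)) => //.
- exact: tuple_measurable_rectangles.
- move=> _ _ [A mA <-] [B mB <-]; exists (fun k => A k `&` B k).
    by move=> k; exact: measurableI.
  apply/seteqP; split=> t.
    by move=> h; split=> k; have [] := h k.
  by move=> [h1 h2] k; split.
- by rewrite bigcup_const//; exists 0%N.
- by move=> _ [A mA <-]; exact: m12.
- move=> k; apply: (@le_lt_trans _ _ 1%E); last exact: ltry.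
  exact: probability_le1.
Qed.

End tuple_law.

Section flip.
Context {d} {T : measurableType d} {R : realType} (P : probability T R).
Context {I : choiceType} (X : I -> {RV P >-> R}).
Notation TR := (measurableTypeR R).
Hypothesis X_indep : mutually_independent X.
Hypothesis X_sym : forall i, symmetrically_distributed (X i).
Context {n : nat} (s : 'I_n -> I) (s_inj : injective s).

Definition sample (w : T) : n.-tuple TR := [tuple X (s k) w : TR | k < n].

Definition flip (i : 'I_n) (t : n.-tuple TR) : n.-tuple TR :=
  [tuple if k == i then (- (tnth t k : R) : TR) else tnth t k | k < n].

Lemma measurable_sample : measurable_fun setT sample.
Proof.
apply/measurable_fun_tnthP => k.
have mX : measurable_fun setT (X (s k)) by exact: measurable_funP.
rewrite (_ : _ \o _ = X (s k) :> (T -> R)); first exact: mX.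
by apply/funext => w /=; rewrite tnth_mktuple.
Qed.

Lemma measurable_flip i : measurable_fun setT (flip i).
Proof.
apply/measurable_fun_tnthP => k.
have mk : @measurable_fun _ _ (n.-tuple TR) TR setT (fun t => tnth t k)
  by exact: measurable_tnth.
have [ki|ki] := eqVneq k i.
  rewrite (_ : _ \o _ = (fun t => - (tnth t k : R) : TR)); first exact: measurable_funN.
  by apply/funext => t /=; rewrite tnth_mktuple ki eqxx.
rewrite (_ : _ \o _ = (fun t => tnth t k))//.
by apply/funext => t /=; rewrite tnth_mktuple (negbTE ki).
Qed.

Lemma sample_rectangle (A : 'I_n -> set TR) : (forall k, measurable (A k)) ->
  P (sample @^-1` rectangle A) = (\prod_(k < n) P (X (s k) @^-1` A k))%E.
Proof.
move=> mA.
pose J : {fset I} := [fset s k | k in 'I_n]%fset.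
(* Independence speaks of families indexed by [I]: the sides are carried along the injection [s],
   with the whole line elsewhere. *)
pose A' (j : I) : set R := if [pick k | s k == j] is Some k then A k else setT.
have A'E k : A' (s k) = A k.
  by rewrite /A'; case: pickP => [l /eqP/s_inj ->//|/(_ k)]; rewrite eqxx.
have := @X_indep J A' _; rewrite big_imfset//=; last by move=> ? ? _ _; exact: s_inj.
rewrite (_ : \bigcap_(i in [set` J]) _ = sample @^-1` rectangle A); last first.
  apply/seteqP; split=> w /=.
    move=> h k; rewrite tnth_mktuple -A'E; apply: (h (s k)).
    by apply/imfsetP; exists k.
  move=> h _ /= /imfsetP[k _ ->]; rewrite A'E; have := h k.
  by rewrite tnth_mktuple.
move=> ->; last first.
  by move=> _ /imfsetP[k _ ->]; rewrite A'E; exact: mA.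
by rewrite big_enum/=; apply: eq_bigr => k _; rewrite A'E.
Qed.

Lemma sample_flip_rectangle i (A : 'I_n -> set TR) : (forall k, measurable (A k)) ->
  P ((flip i \o sample) @^-1` rectangle A) = P (sample @^-1` rectangle A).
Proof.
move=> mA.
pose A' k : set TR := if k == i then (fun x : R => - x : TR) @^-1` A k else A k.
have mA' k : measurable (A' k).
  rewrite /A'; case: ifP => // _.
  rewrite -[X in measurable X]setTI.
  have mN : @measurable_fun _ _ TR TR setT (fun x : R => - x) by exact: measurable_funN.
  exact: mN.
rewrite (_ : (flip i \o sample) @^-1` _ = sample @^-1` rectangle A'); last first.
  apply/seteqP; split=> w /= h k; have := h k; rewrite /A' !tnth_mktuple;
    case: ifP => //.
rewrite !sample_rectangle//; apply: eq_bigr => k _.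
rewrite /A'; case: ifP => // _.
by rewrite [RHS](X_sym (s k) (mA k)).
Qed.

(** The flipped sample has the same law, since both laws agree on rectangles. All later uses of
    independence and symmetry pass through this identity. *)
Lemma integral_flip i (F : n.-tuple TR -> \bar R) :
  measurable_fun setT F -> (forall t, 0 <= F t)%E ->
  (\int[P]_w F (flip i (sample w)) = \int[P]_w F (sample w))%E.
Proof.
move=> mF F0.
pose f1 : {mfun T >-> n.-tuple TR} := HB.pack sample (isMeasurableFun.Build _ _ _ _
  _ measurable_sample).
pose f2 : {mfun T >-> n.-tuple TR} := HB.pack (flip i \o sample)
  (isMeasurableFun.Build _ _ _ _ _ (measurableT_comp (measurable_flip i)
    measurable_sample)).
pose m1 : probability (n.-tuple TR) R := distribution P f1.
pose m2 : probability (n.-tuple TR) R := distribution P f2.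
have E1 : (\int[P]_w F (sample w) = \int[m1]_t F t)%E.
  by rewrite ge0_integral_distribution.
have E2 : (\int[P]_w F (flip i (sample w)) = \int[m2]_t F t)%E.
  by rewrite ge0_integral_distribution.
rewrite E1 E2; apply: eq_measure_integral => B mB _.
apply: tuple_law_unique => // A mA.
exact: sample_flip_rectangle.
Qed.

End flip.

(** * First and second moments of the fields *)

Section moments.
Context {d} {T : measurableType d} {R : realType} (P : probability T R).
Context {I : choiceType} (X : I -> {RV P >-> R}).
Notation TR := (measurableTypeR R).
Hypothesis X_indep : mutually_independent X.
Hypothesis X_sym : forall i, symmetrically_distributed (X i).
Context {n : nat} (s : 'I_n -> I) (s_inj : injective s).

Lemma flip_has_integral i (f : n.-tuple TR -> R) v : measurable_fun setT f ->
  has_integral P (fun w => f (sample X s w)) v ->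
  has_integral P (fun w => f (flip i (sample X s w))) v.
Proof.
move=> mf [If fv].
have mef : measurable_fun setT (EFin \o f) by exact/measurable_EFinP.
have msf : measurable_fun setT (fun w => flip i (sample X s w)).
  by apply: (measurableT_comp (measurable_flip i)); exact: measurable_sample.
split.
- have [_ If'] := (integrableP _ _ _ If).
  apply/integrableP; split.
    by apply/measurable_EFinP; exact: (measurableT_comp mf).
  have E := integral_flip X_indep X_sym s_inj i
    (measurableT_comp (@abse_measurable R setT) mef) (fun t => abse_ge0 _).
  by move: E If' => /= ->.
have Ep (h : T -> n.-tuple TR) : (\int[P]_w (EFin \o (fun w => f (h w)))^\+ w =
    \int[P]_w (EFin \o f)^\+ (h w))%E.
  by apply: eq_integral => w _; rewrite !funeposE.
have En (h : T -> n.-tuple TR) : (\int[P]_w (EFin \o (fun w => f (h w)))^\- w =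
    \int[P]_w (EFin \o f)^\- (h w))%E.
  by apply: eq_integral => w _; rewrite !funenegE.
rewrite -fv [LHS]integralE [RHS]integralE; congr (_ - _)%E.
- rewrite (Ep (sample X s)) (Ep (fun w => flip i (sample X s w))).
  exact: (integral_flip X_indep X_sym s_inj i (measurable_funepos mef)
    (fun t => funepos_ge0 _ t)).
- rewrite (En (sample X s)) (En (fun w => flip i (sample X s w))).
  exact: (integral_flip X_indep X_sym s_inj i (measurable_funeneg mef)
    (fun t => funeneg_ge0 _ t)).
Qed.

(* The negative part of g is dominated by the positive part of the flipped g, which
   has the same law: an expectation of g can then not be -oo. *)
Lemma flip_negative_part i (g : n.-tuple TR -> R) : measurable_fun setT g ->
  (forall t, 0 <= g t + g (flip i t)) ->
  has_expectation P (fun w => g (sample X s w)) ->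
  (\int[P]_w ((EFin \o (fun w => g (sample X s w)))^\- w) < +oo)%E.
Proof.
move=> mg gg [pos|//].
have meg : measurable_fun setT (EFin \o g) by exact/measurable_EFinP.
have ms := measurable_sample X s.
have mgs : measurable_fun setT (EFin \o (fun w => g (sample X s w))).
  by apply/measurable_EFinP; exact: (measurableT_comp mg).
apply: le_lt_trans pos.
have E := integral_flip X_indep X_sym s_inj i (measurable_funepos meg)
    (fun t => funepos_ge0 _ t).
rewrite (_ : (\int[P]_w (EFin \o (fun w => g (sample X s w)))^\+ w)%E =
   (\int[P]_w (EFin \o g)^\+ (sample X s w))%E); last first.
  by apply: eq_integral => w _; rewrite !funeposE.
rewrite -E.
apply: ge0_le_integral => //.
- by apply: measurable_funeneg.
- apply: (measurableT_comp (measurable_funepos meg)).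
  exact: (measurableT_comp (measurable_flip i)).
- move=> w _; rewrite funenegE funeposE /= -EFin_max -EFin_max lee_fin.
  have := gg (sample X s w); move: (g _) (g _) => a b ab.
  by rewrite ge_max !le_max lexx orbT andbT; apply/orP; left; lra.
Qed.

Hypothesis X_id : identically_distributed X.
Variable i0 : I.
Hypothesis X_sq : ('E_P[fun w => (X i0 w ^+ 2)%R] < +oo)%E.

Definition second_moment : R := fine ('E_P[fun w => (X i0 w ^+ 2)%R])%E.

Lemma measurable_X i : measurable_fun setT (X i). Proof. exact: measurable_funP. Qed.

Lemma has_integral_sq i : has_integral P (fun w => X i w ^+ 2) second_moment.
Proof.
have msq : measurable_fun setT (fun x : R => (x ^+ 2)%:E).
  apply/measurable_EFinP; exact: measurable_funX.
have E : (\int[P]_w (X i w ^+ 2)%:E = \int[P]_w (X i0 w ^+ 2)%:E)%E.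
  rewrite -(@ge0_integral_distribution _ _ _ _ _ P (X i) (fun x => (x ^+ 2)%:E))//;
    last first.
    by move=> x; rewrite lee_fin sqr_ge0.
  rewrite -(@ge0_integral_distribution _ _ _ _ _ P (X i0) (fun x => (x ^+ 2)%:E))//;
    last first.
    by move=> x; rewrite lee_fin sqr_ge0.
  by apply: eq_measure_integral => A mA _; exact: X_id.
rewrite /second_moment; move: X_sq; rewrite unlock -E => Xoo.
apply: has_integral_ge0 => // [|w]; last exact: sqr_ge0.
by apply: measurable_funX; exact: measurable_X.
Qed.

Lemma second_moment_ge0 : 0 <= second_moment.
Proof. by apply: fine_ge0; apply: expectation_ge0 => w; exact: sqr_ge0. Qed.

Lemma has_integral_cst c : has_integral P (fun=> c) c.
Proof.
split; first exact: finite_measure_integrable_cst.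
rewrite -[RHS]mule1 -(@probability_setT _ _ _ P).
exact: (integral_cst P measurableT c%:E).
Qed.

Lemma integrable_XX i j : P.-integrable setT (EFin \o (fun w => X i w * X j w)).
Proof.
have [I1 _] := has_integralD (has_integral_sq i) (has_integral_sq j).
apply: integrable_dominated I1.
  by apply: measurable_funM; exact: measurable_X.
move=> w; rewrite normrM -(real_normK (num_real (X i w))) -(real_normK (num_real (X
  j w))).
move: (normr_ge0 (X i w)) (normr_ge0 (X j w)).
move: (`|X i w|) (`|X j w|) => a b a0 b0; have := sqr_ge0 (a - b).
have := mulr_ge0 a0 b0; rewrite sqrrB; lra.
Qed.

(** Flipping coordinate [k] keeps the expectation and changes its sign. Integrability comes from the
    second moment. *)
Lemma has_integral_X k : has_integral P (X (s k)) 0.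
Proof.
have IX : P.-integrable setT (EFin \o X (s k)).
  have [I1 _] := has_integralD (has_integral_cst 1) (has_integral_sq (s k)).
  apply: integrable_dominated I1; first exact: measurable_X.
  move=> w; rewrite -(real_normK (num_real (X (s k) w))).
  move: (`|X (s k) w|) => a; have := sqr_ge0 (a - 1); rewrite sqrrB1 => h.
  have := sqr_ge0 a; lra.
have h1 := has_integral_integrable IX.
have h2 : has_integral P (fun w => tnth (sample X s w) k : R) (fine (\int[P]_w (X (s
  k) w)%:E)%E).
  by apply: has_integral_ext h1 => w; rewrite tnth_mktuple.
have mk : @measurable_fun _ _ (n.-tuple TR) TR setT (fun t => tnth t k)
  by exact: measurable_tnth.
have h3 := @flip_has_integral k (fun t => tnth t k : R) _ mk h2.
have h4 := has_integralZ (-1) h1.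
have E := has_integral_unique h4 (has_integral_ext _ h3).
have {}E : -1 * fine (\int[P]_w (X (s k) w)%:E)%E = fine (\int[P]_w (X (s k) w)%:E)%E.
  by apply: E => w; rewrite !tnth_mktuple eqxx mulN1r.
by move: h1; move: (fine _) E => v E; have -> : v = 0 by lra.
Qed.

(** Off the diagonal, flipping coordinate [k] alone changes the sign of the product but not its
    expectation. *)
Lemma has_integral_XX k l :
  has_integral P (fun w => X (s k) w * X (s l) w) (if k == l then second_moment else 0).
Proof.
case: eqP => [->|/eqP kl].
  by apply: has_integral_ext (has_integral_sq (s l)) => w; rewrite expr2.
have h1 := has_integral_integrable (integrable_XX (s k) (s l)).
set v := fine _ in h1.
have h2 : has_integral P (fun w => (tnth (sample X s w) k : R) * tnth (sample X s w)
  l) v.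
  by apply: has_integral_ext h1 => w; rewrite !tnth_mktuple.
have mk : measurable_fun [set: n.-tuple TR] (fun t : n.-tuple TR => (tnth t k : R) *
  tnth t l).
  by apply: measurable_funM; exact: measurable_tnth.
have h3 := @flip_has_integral k (fun t => (tnth t k : R) * tnth t l) _ mk h2.
have h4 := has_integralZ (-1) h1.
have E : -1 * v = v.
  apply: (has_integral_unique h4); apply: has_integral_ext h3 => w.
  by rewrite !tnth_mktuple eqxx eq_sym (negbTE kl) mulN1r mulNr.
by have -> : 0 = v by lra.
Qed.

Lemma has_integral_sqsum (p : pred 'I_n) (a : 'I_n -> R) :
  has_integral P (fun w => (\sum_(k < n | p k) a k * X (s k) w) ^+ 2)
    (second_moment * \sum_(k < n | p k) a k ^+ 2).
Proof.
have h : has_integral P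
   (fun w => \sum_(k < n | p k) \sum_(l < n | p l) (a k * a l) * (X (s k) w * X (s
     l) w))
   (\sum_(k < n | p k) \sum_(l < n | p l) (a k * a l) * (if k ==
     l then second_moment else 0)).
  by do 2 (apply: has_integral_sum => ? _); apply: has_integralZ;
    exact: has_integral_XX.
apply: (has_integral_ext (f := fun w => \sum_(k < n | p k) \sum_(l < n | p l) (a k *
  a l) * (X (s k) w * X (s l) w))).
  move=> w; rewrite expr2 mulr_suml; apply: eq_bigr => k _.
  by rewrite mulr_sumr; apply: eq_bigr => l _; ring.
rewrite (_ : second_moment * _ = \sum_(k < n | p k) \sum_(l < n | p l) (a k * a l) *
  (if k == l then second_moment else 0))//.
rewrite mulr_sumr; apply: eq_bigr => k pk.
rewrite (bigD1 k)//= eqxx big1 ?addr0; last first.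
  by move=> l /andP[_ lk]; rewrite eq_sym (negbTE lk) mulr0.
by rewrite expr2 mulrC.
Qed.

End moments.

(** * The finite-volume Gibbs measure *)

Section pinning_monotone.
Local Open Scope ereal_scope.
Context {R : realType}.
Notation TR := (measurableTypeR R).

Lemma power_pinning_ge n (eps : {nonneg R}) (w : n.-tuple TR -> \bar R) :
  measurable_fun setT w -> (forall t, 0 <= w t) ->
  \int[power_measure (@pinning_measure R (0%:nng)%R) n]_t w t <=
  \int[power_measure (pinning_measure eps) n]_t w t.
Proof.
elim: n w => [|n IH] w mw w0; first by [].
have mwc (v : n.-tuple TR) : @measurable_fun _ _ TR _ setT (fun y : TR => w [tuple
  of y :: v]).
  by apply: (measurableT_comp mw); exact: measurable_cons.
have mg := @measurable_inner_integral _ TR R (@lebesgue_measure R) n w mw w0.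
have g0 (t : n.-tuple TR) : 0 <= \int[lebesgue_measure]_y w [tuple of y :: t]
  by exact: integral_ge0.
rewrite ge0_integral_power_pinning0S// integral_power_measureS//.
apply: (le_trans (IH _ mg g0)).
apply: ge0_le_integral => //.
  exact: (measurable_inner_integral (pinning_measure eps) mw w0).
move=> t _; rewrite (ge0_integral_pinning eps (mwc t))//.
by rewrite leeDl// mule_ge0// lee_fin.
Qed.

End pinning_monotone.

(** Infinite values are allowed, even [+oo - +oo]: a positive finite factor preserves each infinity.
    This scales an integral before its integrability is known. *)
Lemma EFin_pmuleBr {R : realDomainType} (c : R) (a b : \bar R) : 0 < c ->
  (c%:E * (a - b) = c%:E * a - c%:E * b)%E.
Proof.
move=> c0; have ce0 : (0 < c%:E)%E by rewrite lte_fin.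
by case: a => [a| |]; case: b => [b| |];
  rewrite ?(gt0_muley ce0, gt0_muleNy ce0)//= ?(gt0_muley ce0, gt0_muleNy ce0)//=
    -?EFinM ?mulrBr.
Qed.

Section finite_volume.
Context {R : realType}.
Variable V : R -> R.
Hypothesis V_derivable : forall t : R, derivable V t 1.
Hypothesis V_derivable2 : forall t : R, derivable (derive1 V) t 1.
Hypothesis V_second_derivative : forall t : R, derive1n 2 V t <= 1.
Hypothesis V_growth : (1 < limf_einf (fun t : R => (ln (V t) / ln `|t|)%:E)
                             (abs_pinfty R))%E.
Variable L : nat.
Notation TR := (measurableTypeR R).
Notation conf := (@config R 2 (box 2 L)).
Notation n := #|{: box 2 L}|.
Notation H := (@energy R 2 (box 2 L) V).

Let mH : measurable_fun setT H.
Proof. apply: measurable_energy; exact: (potential_continuous (@V_derivable)). Qed.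

Let Hq : forall phi psi : conf,
  H (addt phi psi) + H (addt phi (scalet (-1) psi)) <= 2 * H phi + sqenergy psi.
Proof.
apply: energy_midpoint.
exact: (potential_midpoint (@V_derivable) (@V_derivable2) V_second_derivative).
Qed.

Let qdelta (i : 'I_n) s : sqenergy (deltat i s : conf) <= 2 * s ^+ 2.
Proof. exact: sqenergy_deltat. Qed.

Let Hcoercive : forall M : R, exists C : R, forall phi : conf,
  M * \sum_(i < n) `|tnth phi i : R| - C <= H phi.
Proof. apply: energy_coercive; exact: (potential_superlinear (@V_derivable)
  V_growth). Qed.

Section fixed_pinning.
Variable eps : {nonneg R}.

Let ref : {measure set conf -> \bar R} := power_measure (pinning_measure eps) n.

Definition gibbs_partition : conf -> R := partition_fn ref H.

Definition gibbs_mean : conf -> 'I_n -> R := mean ref H.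

Let Wlty h : (\int[ref]_phi (weight H h phi)%:E < +oo)%E.
Proof. exact: (weight_lty mH Hq qdelta _ Hcoercive). Qed.

Let Wgt0 h : (0 < \int[ref]_phi (weight H h phi)%:E)%E.
Proof. exact: (weight_integral_gt0 mH). Qed.

Lemma gibbs_partitionE h : has_integral ref (weight H h) (gibbs_partition h).
Proof. exact: partition_fnE. Qed.

Lemma gibbs_partition_gt0 h : 0 < gibbs_partition h.
Proof. exact: partition_fn_gt0. Qed.

Lemma gibbs_meanE h i : has_integral ref
  (fun phi : conf => (tnth phi i : R) * weight H h phi) (gibbs_partition h *
    gibbs_mean h i).
Proof. exact: meanE. Qed.

Lemma gibbs_expectation_height (eta : site 2 -> R) (i : box 2 L) :
  gibbs_expectation V eps eta (fun phi => height phi i) =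
    gibbs_mean (field (box 2 L) eta) (enum_rank i).
Proof.
set h := field _ eta; set k := enum_rank i.
have E : @boltzmann_weight R 2 V (box 2 L) eta = weight H h.
  by apply/funext => phi; exact: boltzmann_weightE.
have [_ Zh] := gibbs_partitionE h.
have Z0 := gibbs_partition_gt0 h.
have PF : fine (partition_function V eps (box 2 L) eta) = gibbs_partition h.
  by rewrite /partition_function E /reference_measure -/ref Zh.
have c0 : 0 <= (gibbs_partition h)^-1 by rewrite invr_ge0 ltW.
have w0 phi : 0 <= weight H h phi by rewrite ltW// weight_gt0.
have mw := measurable_weight mH h.
(* Here the bare set function [gibbs] is identified with a genuine measure, to which the integration
   lemmas apply. *)
have G : @gibbs R 2 V eps (box 2 L) eta = mscale (NngNum c0) (density ref mw w0).
  by apply/funext => A; rewrite /gibbs PF E.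
have mf : measurable_fun setT (fun phi : conf => (height phi i)%:E).
  by apply/measurable_EFinP; exact: measurable_height.
rewrite /gibbs_expectation G.
have -> : (\int[mscale (NngNum c0) (density ref mw w0)]_phi (height phi i)%:E =
    (gibbs_partition h)^-1%:E * \int[density ref mw w0]_phi (height phi i)%:E)%E.
  rewrite [in LHS]integralE [in RHS]integralE.
  rewrite (ge0_integral_mscale (density ref mw w0) measurableT (NngNum c0)
    (measurable_funepos mf)); last first.
    by move=> x _; exact: funepos_ge0.
  rewrite (ge0_integral_mscale (density ref mw w0) measurableT (NngNum c0)
    (measurable_funeneg mf)); last first.
    by move=> x _; exact: funeneg_ge0.
  by rewrite [RHS]EFin_pmuleBr// invr_gt0.
rewrite integral_density; last exact: measurable_height.
have [_ ->] := gibbs_meanE h k.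
by rewrite -EFinM /= mulKf// gt_eqF.
Qed.

End fixed_pinning.

Lemma gibbs_partition_pinning_ge (eps : {nonneg R}) h : gibbs_partition (0%:nng)%R h
  <= gibbs_partition eps h.
Proof.
have [_ E0] := gibbs_partitionE (0%:nng)%R h; have [_ E1] := gibbs_partitionE eps h.
rewrite -lee_fin -E0 -E1; apply: power_pinning_ge.
  by apply/measurable_EFinP; exact: measurable_weight.
by move=> t; rewrite lee_fin ltW// weight_gt0.
Qed.

(** The exponent [2 / 2] is [kappa / 2] for the value [kappa = 2] of [sqenergy_deltat]. *)
Lemma gibbs_partition_pinning_le (eps : {nonneg R}) h :
  gibbs_partition eps h <= (1 + eps%:num * expR (2 / 2)) ^+ n * gibbs_partition
    (0%:nng)%R h.
Proof.
have [_ E0] := gibbs_partitionE (0%:nng)%R h; have [_ E1] := gibbs_partitionE eps h.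
rewrite -lee_fin EFinM -E0 -E1.
exact: (pinned_weight_le mH Hq qdelta).
Qed.

Lemma gibbs_mean_monotone (eps : {nonneg R}) (h h' : conf) :
  0 <= \sum_(i < n) ((tnth h' i : R) - tnth h i) * (gibbs_mean eps h' i - gibbs_mean
    eps h i).
Proof.
exact: (mean_monotone (gibbs_partitionE eps) (gibbs_partition_gt0 eps) (gibbs_meanE
  eps)).
Qed.

(** After Jensen's inequality, [ln Z] with pinning is needed from below at [h] and from above at the
    zero field. The first comparison is free; the second costs one logarithm per site. *)
Lemma gibbs_mean_lower_bound (eps : {nonneg R}) (K : conf -> conf) (h : conf) :
  (forall a h, K (scalet a h) = scalet a (K h)) ->
  \sum_(i < n) (tnth h i : R) * gibbs_mean (0%:nng)%R [tuple 0 : TR | i < n] i +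
  quad (@sqenergy R 2 (box 2 L)) K h -
  n%:R * ln (1 + eps%:num * expR (2 / 2)) <=
  \sum_(i < n) (tnth h i : R) * gibbs_mean eps h i.
Proof.
move=> KZ.
have z0E g : scalet 0 g = [tuple 0 : TR | i < n] :> conf.
  by apply: eq_from_tnth => i; rewrite !tnth_mktuple mul0r.
set z0 : conf := [tuple 0 : TR | i < n].
have A := lnZ_jensen (gibbs_partitionE eps) (gibbs_partition_gt0 eps) (gibbs_meanE
  eps) h z0.
have shift_inv (f : conf -> \bar R) (u : conf) : measurable_fun setT f -> (forall t,
  0 <= f t)%E ->
    (\int[power_measure (@pinning_measure R (0%:nng)%R) n]_t f (addt t u) =
     \int[power_measure (@pinning_measure R (0%:nng)%R) n]_t f t)%E.
  exact: ge0_integral_power_shift.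
have B := lnZ_quad mH (gibbs_partitionE (0%:nng)%R) (gibbs_partition_gt0 (0%:nng)%R)
  (gibbs_meanE (0%:nng)%R)
  shift_inv Hq KZ (@sqenergyZ R 2 (box 2 L)) h.
rewrite z0E -/z0 in B.
have C0 : 0 < 1 + eps%:num * expR (2 / 2) by rewrite ltr_pwDl// mulr_ge0// expR_ge0.
have C1 : ln (gibbs_partition (0%:nng)%R h) <= ln (gibbs_partition eps h).
  by rewrite ler_ln ?posrE ?gibbs_partition_gt0// gibbs_partition_pinning_ge.
have C2 : ln (gibbs_partition eps z0) <= n%:R * ln (1 + eps%:num * expR (2 / 2)) +
  ln (gibbs_partition (0%:nng)%R z0).
  rewrite mulr_natl -lnXn// -lnM ?posrE ?exprn_gt0 ?gibbs_partition_gt0//.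
  by rewrite ler_ln ?posrE ?mulr_gt0 ?exprn_gt0 ?gibbs_partition_gt0//
    gibbs_partition_pinning_le.
have D : \sum_(i < n) ((tnth z0 i : R) - tnth h i) * gibbs_mean eps h i =
    - \sum_(i < n) (tnth h i : R) * gibbs_mean eps h i.
  rewrite -sumrN; apply: eq_bigr => i _.
  by rewrite tnth_mktuple sub0r mulNr.
rewrite D in A.
move: A B C1 C2; move: (ln _) (ln _) (ln _) (ln _) (_ * ln _) (\sum_(i < n) _)
  (\sum_(i < n) _) (quad _ _ _).
move=> a b c e f g i j; lra.
Qed.

Lemma measurable_gibbs_mean (eps : {nonneg R}) i : measurable_fun setT (fun h : conf
  => gibbs_mean eps h i).
Proof.
have mW : measurable_fun [set: (conf * conf)%type] (fun p : conf * conf => weight H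
  p.1 p.2).
  apply: (measurableT_comp (@measurable_expR R)).
  apply: measurable_funD.
    by apply: measurable_funN; exact: (measurableT_comp mH).
  apply: measurable_sum => k; apply: measurable_funM.
    exact: (measurableT_comp (measurable_tnth k)).
  exact: (measurableT_comp (measurable_tnth k)).
have mF : measurable_fun [set: (conf * conf)%type]
    (fun p : conf * conf => ((tnth p.2 i : R) * weight H p.1 p.2)%:E).
  apply/measurable_EFinP; apply: measurable_funM => //.
  exact: (measurableT_comp (measurable_tnth i)).
rewrite /gibbs_mean /mean; apply: measurable_funM.
  apply: (measurableT_comp (@fine_measurable R setT measurableT)).
  under eq_fun do rewrite integralE.
  apply: emeasurable_funB.
    apply: (@measurable_power_integral _ _ _ (pinning_measure eps) _ conf n
      (fun h phi => (fun phi : conf => ((tnth phi i : R) * weight H h phi)%:E)^\+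
        phi)%E).
      rewrite [X in measurable_fun _ X](_ : _ = (fun p : conf * conf =>
        ((tnth p.2 i : R) * weight H p.1 p.2)%:E)^\+)%E;
          first exact: measurable_funepos.
      by apply/funext => p; rewrite !funeposE.
    by move=> h phi; exact: funepos_ge0.
  apply: (@measurable_power_integral _ _ _ (pinning_measure eps) _ conf n
      (fun h phi => (fun phi : conf => ((tnth phi i : R) * weight H h phi)%:E)^\-
        phi)%E).
    rewrite [X in measurable_fun _ X](_ : _ = (fun p : conf * conf =>
      ((tnth p.2 i : R) * weight H p.1 p.2)%:E)^\-)%E; first exact: measurable_funeneg.
    by apply/funext => p; rewrite !funenegE.
  by move=> h phi; exact: funeneg_ge0.
(* Positivity of the partition function lets its inverse be written as [exp (- ln Z)], a composition
   of measurable maps. *)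
rewrite (_ : (fun _ => _) = (fun h : conf => expR (- ln (gibbs_partition eps h))));
  last first.
  by apply/funext => h; rewrite expRN lnK ?posrE ?gibbs_partition_gt0.
apply: (measurableT_comp (@measurable_expR R)); apply: measurable_funN.
apply: (measurableT_comp (@measurable_ln R)).
apply: (measurableT_comp (@fine_measurable R setT measurableT)).
apply: (@measurable_power_integral _ _ _ (pinning_measure eps) _ conf n
  (fun h phi => (weight H h phi)%:E)).
  exact/measurable_EFinP.
by move=> h phi; rewrite lee_fin ltW// weight_gt0.
Qed.


End finite_volume.

(** * Expectation of the quadratic lower bound *)

Section box_card.

Lemma box_site_inj d L : injective (@box_site d L).
Proof.
move=> f g /rowP fg; apply/ffunP => k; have := fg k; rewrite !mxE.
by move=> /addIr[] /val_inj.
Qed.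

Lemma card_box d L : #|` box d L| = (L.*2.+1 ^ d)%N.
Proof.
rewrite card_imfset/=; last exact: box_site_inj.
by rewrite -cardE card_ffun !card_ord.
Qed.

Lemma box_sub d M L : (M <= L)%N -> {subset box d M <= box d L}.
Proof.
move=> ML x; rewrite !mem_box => /forallP h; apply/forallP => k.
by apply: (le_trans (h k)); rewrite lez_nat.
Qed.

End box_card.

(** * The random test configuration *)

Section kernel.
Context {d} {T : measurableType d} {R : realType} (P : probability T R).
Variable eta : site 2 -> {RV P >-> R}.
Hypothesis eta_indep : mutually_independent eta.
Hypothesis eta_id : identically_distributed eta.
Hypothesis eta_sym : forall i, symmetrically_distributed (eta i).
Hypothesis eta_sq : ('E_P[fun w => (eta 0%R w ^+ 2)%R] < +oo)%E.
Variables (L M : nat) (c : R).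
Notation TR := (measurableTypeR R).
Notation conf := (@config R 2 (box 2 L)).
Notation n := #|{: box 2 L}|.

Definition box_enum (k : 'I_n) : site 2 := fsval (enum_val k : box 2 L).

Lemma box_enum_inj : injective box_enum.
Proof. by move=> k l /val_inj /enum_val_inj. Qed.

(** A substitute for the Green operator: the field at each site of the smaller box is answered by a
    truncated logarithm centred there. The field enters linearly, as the halving argument
    requires. *)
Definition kernel_map (h : conf) : conf :=
  [tuple c * \sum_(k < n | box_enum k \in box 2 M)
    profile M (box_enum i - box_enum k) * tnth h k : TR | i < n].

Lemma kernel_mapZ a h : kernel_map (scalet a h) = scalet a (kernel_map h).
Proof.
apply: eq_from_tnth => i; rewrite !tnth_mktuple mulrCA; congr (_ * _).
by rewrite mulr_sumr; apply: eq_bigr => k _; rewrite tnth_mktuple mulrCA.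
Qed.

Notation s2 := (second_moment eta 0).
Notation field_at := (sample eta box_enum).
Notation inM := (fun k => box_enum k \in box 2 M).

Lemma kernel_dot : has_integral P (fun w => dot (field_at w) (kernel_map (field_at w)))
  (s2 * \sum_(k < n | inM k) c * harm M).
Proof.
have h : has_integral P
   (fun w => \sum_(i < n) \sum_(k < n | inM k)
      (c * profile M (box_enum i - box_enum k)) * (eta (box_enum i) w * eta
        (box_enum k) w))
   (\sum_(i < n) \sum_(k < n | inM k)
      (c * profile M (box_enum i - box_enum k)) * (if i == k then s2 else 0)).
  do 2 (apply: has_integral_sum => ? _); apply: has_integralZ.
  exact: has_integral_XX box_enum_inj _ _ _ _ _.
rewrite (_ : s2 * _ = \sum_(i < n) \sum_(k < n | inM k)
      (c * profile M (box_enum i - box_enum k)) * (if i == k then s2 else 0));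
        last first.
  rewrite exchange_big mulr_sumr/=; apply: eq_bigr => k _.
  rewrite (bigD1 k)//= eqxx big1 ?addr0; last by move=> i /negbTE ->; rewrite mulr0.
  by rewrite subrr profile0 mulrC.
apply: has_integral_ext h => w; rewrite /dot; apply: eq_bigr => i _.
rewrite !tnth_mktuple !mulr_sumr; apply: eq_bigr => k _.
by rewrite tnth_mktuple; ring.
Qed.

(** Increments of the test configuration are linear in uncorrelated fields, so the expected energy
    is the sum of the energies of the single profiles. *)
Lemma kernel_sqenergy : has_integral P (fun w => sqenergy (kernel_map (field_at w)))
  (s2 * \sum_(k < n | inM k) c ^+ 2 * sqenergy (profile_config L M (box_enum k))).
Proof.
pose g (i : box 2 L) k : R := c * profile M (fsval i - box_enum k).
have hK w i : height (kernel_map (field_at w)) i =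
  \sum_(k < n | inM k) g i k * eta (box_enum k) w.
  rewrite /height tnth_mktuple mulr_sumr; apply: eq_bigr => k _.
  by rewrite /g tnth_mktuple mulrA /box_enum enum_rankK.
have sq := has_integral_sqsum eta_indep eta_sym box_enum_inj eta_id eta_sq inM.
have h1 : has_integral P (fun w => bulk_energy (fun t => t ^+ 2) (kernel_map
  (field_at w)))
    (\sum_(i : box 2 L) \sum_(j : box 2 L | fsval j \in up_neighbours (fsval i))
       s2 * \sum_(k < n | inM k) (g i k - g j k) ^+ 2).
  apply: has_integral_sum => i _; apply: has_integral_sum => j _.
  apply: has_integral_ext (sq (fun k => g i k - g j k)) => w.
  rewrite !hK -sumrB; congr (_ ^+ 2); apply: eq_bigr => k _; by rewrite mulrBl.
have h2 : has_integral P (fun w => boundary_energy (fun t => t ^+ 2) (kernel_map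
  (field_at w)))
    (\sum_(i : box 2 L) \sum_(j <- neighbours (fsval i) | j \notin box 2 L)
       s2 * \sum_(k < n | inM k) (g i k) ^+ 2).
  apply: has_integral_sum => i _; apply: has_integral_sum => j _.
  by apply: has_integral_ext (sq (fun k => g i k)) => w; rewrite hK.
have := has_integralD (has_integralZ ((4 * 2)%:R^-1) h1) (has_integralZ ((4 *
  2)%:R^-1) h2).
rewrite (_ : _ + _ = s2 * \sum_(k < n | inM k) c ^+ 2 * sqenergy (profile_config L M
  (box_enum k)))//.
have hp k i : c * height (profile_config L M (box_enum k)) i = g i k.
  by rewrite /height tnth_mktuple enum_rankK.
rewrite -mulrDr mulrC; under eq_bigr do rewrite -mulr_sumr.
rewrite -mulr_sumr; under [X in _ + X]eq_bigr do rewrite -mulr_sumr.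
rewrite -[X in _ + X]mulr_sumr -mulrDr -mulrA; congr (_ * _).
under [RHS]eq_bigr do rewrite /sqenergy /energy -mulrDr mulrCA.
rewrite -mulr_sumr mulrC; congr (_ * _).
rewrite -(_ : \sum_(k < n | inM k) (c ^+ 2 * bulk_energy (fun t => t ^+ 2)
  (profile_config L M (box_enum k)))
  + \sum_(k < n | inM k) (c ^+ 2 * boundary_energy (fun t => t ^+ 2) (profile_config
    L M (box_enum k))) = \sum_(k < n | inM k) _); last first.
  by rewrite -big_split/=; apply: eq_bigr => k _; rewrite mulrDr.
congr (_ + _).
- under eq_bigr do rewrite exchange_big/=.
  rewrite exchange_big/=; apply: eq_bigr => k _.
  rewrite /bulk_energy mulr_sumr; apply: eq_bigr => i _.
  rewrite mulr_sumr; apply: eq_bigr => j _.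
  by rewrite -!hp -mulrBr exprMn.
- under eq_bigr do rewrite exchange_big/=.
  rewrite exchange_big/=; apply: eq_bigr => k _.
  rewrite /boundary_energy mulr_sumr; apply: eq_bigr => i _.
  rewrite mulr_sumr; apply: eq_bigr => j _.
  by rewrite -!hp exprMn.
Qed.

End kernel.

Section kernel_bound.
Context {d} {T : measurableType d} {R : realType} (P : probability T R).
Variable eta : site 2 -> {RV P >-> R}.
Hypothesis eta_indep : mutually_independent eta.
Hypothesis eta_id : identically_distributed eta.
Hypothesis eta_sym : forall i, symmetrically_distributed (eta i).
Hypothesis eta_sq : ('E_P[fun w => (eta 0%R w ^+ 2)%R] < +oo)%E.
Variables (L M : nat).
Notation conf := (@config R 2 (box 2 L)).
Notation n := #|{: box 2 L}|.

(** Each site of the smaller box contributes at least [(c - 16 c^2) harm M]; the maximum is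
    [1 / 64], at [c = 1 / 32]. *)
Lemma kernel_quad : (M + M <= L)%N -> (0 < M)%N -> exists2 v : R,
  has_integral P (fun w => quad (@sqenergy R 2 (box 2 L)) (kernel_map M 32^-1)
    (sample eta (@box_enum L) w)) v &
  64^-1 * second_moment eta 0 * (M.*2.+1 ^ 2)%:R * harm M <= v.
Proof.
move=> ML M0; set s2 := second_moment eta 0.
have s20 : 0 <= s2 by exact: second_moment_ge0.
have h1 := kernel_dot eta_indep eta_id eta_sym eta_sq L M 32^-1.
have h2 := kernel_sqenergy eta_indep eta_id eta_sym eta_sq L M 32^-1.
have := has_integralD h1 (has_integralZ (- 2^-1) h2).
set v := (X in has_integral _ _ X) => hv; exists v.
  by apply: has_integral_ext hv => w; rewrite /quad mulNr [X in _ - X]mulrC.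
have e (k : 'I_n) : box_enum k \in box 2 M -> 64^-1 * harm M <=
    32^-1 * harm M - 2^-1 * (32^-1 ^+ 2 * sqenergy (profile_config L M (box_enum
      k))) :> R.
  by move=> kM; have := @sqenergy_profile R L M _ kM ML M0; lra.
have -> : v = s2 * \sum_(k < n | box_enum k \in box 2 M)
   (32^-1 * harm M - 2^-1 * (32^-1 ^+ 2 * sqenergy (profile_config L M (box_enum k)))).
  by rewrite /v -/s2 [in RHS]sumrB mulrBr mulNr -[X in _ =
    _ - s2 * X]mulr_sumr [in RHS]mulrCA.
rewrite (_ : _ * harm M = s2 * \sum_(k < n | box_enum k \in box 2 M) 64^-1 * harm
  M); last first.
  rewrite sumr_const -mulr_natr; have -> : #|[pred k : 'I_n | box_enum k \in box 2
    M]| = (M.*2.+1 ^ 2)%N.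
    rewrite -card_box.
    transitivity #|` [fset box_enum k | k in [pred k : 'I_n | box_enum k \in box 2
      M]]%fset|.
      by rewrite card_imfset /= ?cardE//; exact: box_enum_inj.
    congr (#|` _|); apply/fsetP => x; apply/imfsetP/idP => /= [[k kM ->//]|xM].
    have xL : x \in box 2 L.
      by apply: (box_sub _ xM); rewrite (leq_trans _ ML)// leq_addr.
    have bE : box_enum (enum_rank ([` xL]%fset : box 2 L)) = x.
      by rewrite /box_enum enum_rankK.
    exists (enum_rank ([` xL]%fset : box 2 L)) => //.
    by apply: (etrans _ xM); rewrite -{2}bE.
  by ring.
by rewrite ler_wpM2l// ler_sum.
Qed.

End kernel_bound.

(** * The growth of the overlap *)

Section integral_lower_bounds.
Context d (T : measurableType d) (R : realType) (m : {measure set T -> \bar R}).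

(** The integral of [f] may be [+oo], so positive and negative parts are compared separately. *)
Lemma integral_ge_has_integral (g f : T -> R) v : has_integral m g v ->
  measurable_fun setT f -> (forall x, g x <= f x) ->
  (v%:E <= \int[m]_x (f x)%:E)%E.
Proof.
move=> [Ig gv] mf gf; rewrite -gv [leLHS]integralE [leRHS]integralE.
have mg := measurable_int m Ig.
have mef : measurable_fun setT (EFin \o f) by exact/measurable_EFinP.
apply: leeB.
- apply: ge0_le_integral => //; [exact: measurable_funepos|exact: measurable_funepos|].
  move=> x _; rewrite !funeposE -!EFin_max lee_fin ge_max !le_max.
  by rewrite (gf x) lexx orbT.
- apply: ge0_le_integral => //; [exact: measurable_funeneg|exact: measurable_funeneg|].
  move=> x _; rewrite !funenegE -!EFin_max lee_fin ge_max !le_max.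
  by rewrite lerN2 (gf x) lexx orbT.
Qed.

(** Finite negative parts exclude [-oo]. Either some positive part is infinite and the sum is [+oo],
    or every [f i] is integrable and the integral is additive. *)
Lemma sum_integral_ge_has_integral (I : finType) (g : T -> R) (f : I -> T -> R) v :
  has_integral m g v -> (forall i, measurable_fun setT (f i)) ->
  (forall x, g x <= \sum_(i : I) f i x) ->
  (forall i, \int[m]_x ((EFin \o f i)^\- x) < +oo)%E ->
  (v%:E <= \sum_(i : I) \int[m]_x (f i x)%:E)%E.
Proof.
move=> gv mf gf neg.
have fE i : (\int[m]_x (f i x)%:E = \int[m]_x (EFin \o f i)^\+ x - \int[m]_x (EFin
  \o f i)^\- x)%E.
  exact: integralE.
have mef i : measurable_fun setT (EFin \o f i) by exact/measurable_EFinP.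
have p0 i : (0 <= \int[m]_x (EFin \o f i)^\+ x)%E.
  by apply: integral_ge0 => x _; exact: funepos_ge0.
have n0 i : (0 <= \int[m]_x (EFin \o f i)^\- x)%E.
  by apply: integral_ge0 => x _; exact: funeneg_ge0.
have nf i : (\int[m]_x (EFin \o f i)^\- x)%E \is a fin_num by rewrite ge0_fin_numE.
have [[i fi]|allf] := pselect (exists i, \int[m]_x (EFin \o f i)^\+ x = +oo)%E.
  rewrite (_ : \sum_(i : I) _ = +oo)%E ?leey//; apply/eqP.
  rewrite esum_eqy; last first.
    move=> j _; rewrite fE.
    move: (nf j) (p0 j); case: (\int[m]_x (EFin \o f j)^\- x)%E => // r _.
    by case: (\int[m]_x (EFin \o f j)^\+ x)%E.
  apply/existsP; exists i; rewrite /= fE fi.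
  by move: (nf i); case: (\int[m]_x (EFin \o f i)^\- x)%E.
have If i : has_integral m (f i) (fine (\int[m]_x (f i x)%:E)%E).
  apply: has_integral_integrable; apply/integrableP; split => //.
  rewrite (_ : (\int[m]_x `|(EFin \o f i) x|)%E =
    (\int[m]_x ((EFin \o f i)^\+ x + (EFin \o f i)^\- x))%E); last first.
    by apply: eq_integral => x _; rewrite -[LHS]/((abse \o (EFin \o f i)) x) fune_abse.
  rewrite ge0_integralD//; [|exact: measurable_funepos|exact: measurable_funeneg].
  rewrite lte_add_pinfty//; first by rewrite ltey; apply/eqP => h; apply: allf;
    exists i.
have S := has_integral_sum (index_enum I) (p := xpredT) (fun i _ => If i).
rewrite (eq_bigr (fun i => (fine (\int[m]_x (f i x)%:E)%E)%:E)).
  by rewrite sumEFin lee_fin; exact: (has_integral_le gv S).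
by move=> i _; have [_ ->] := If i.
Qed.

End integral_lower_bounds.

Lemma limn_einf_ge {R : realType} (u : nat -> \bar R) (l : R) :
  (forall e : R, 0 < e -> exists N : nat, forall k, (N <= k)%N -> ((l - e)%:E <=
    u k)%E) ->
  (l%:E <= limn_einf u)%E.
Proof.
move=> h; apply/lee_addgt0Pr => e e0.
have [N hN] := h e e0.
rewrite -leeBlDr// -EFinB.
rewrite (_ : limn_einf u = limf_einf u \oo)// limf_einfE.
apply: (@le_trans _ _ (ereal_inf (u @` [set k | (N <= k)%N]))).
  by apply: le_ereal_inf_tmp => _ [k Nk <-]; exact: hN.
apply: ereal_sup_ubound; exists [set k | (N <= k)%N] => //.
by exists N.
Qed.

Definition nng0 {R : realType} : {nonneg R} := (0%:nng)%R.

Section overlap.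
Context {R : realType}.
Variable V : R -> R.
Hypothesis V_derivable : forall t : R, derivable V t 1.
Hypothesis V_derivable2 : forall t : R, derivable (derive1 V) t 1.
Hypothesis V_second_derivative : forall t : R, derive1n 2 V t <= 1.
Hypothesis V_growth : (1 < limf_einf (fun t : R => (ln (V t) / ln `|t|)%:E)
                             (abs_pinfty R))%E.
Context {d} {T : measurableType d} (P : probability T R).
Variable eta : site 2 -> {RV P >-> R}.
Hypothesis eta_indep : mutually_independent eta.
Hypothesis eta_id : identically_distributed eta.
Hypothesis eta_sym : forall i, symmetrically_distributed (eta i).
Hypothesis eta_sq : ('E_P[fun w => (eta 0%R w ^+ 2)%R] < +oo)%E.
Variables (eps : {nonneg R}) (L : nat).
Notation TR := (measurableTypeR R).
Notation conf := (@config R 2 (box 2 L)).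
Notation n := #|{: box 2 L}|.
Notation s2 := (second_moment eta 0).
Notation field_at := (sample eta (@box_enum L)).
Notation M := (@gibbs_mean R V L eps).
Notation lnC := (ln (1 + eps%:num * expR (2 / 2))).

(** The overlap as a function of the tuple of fields, the form on which flips act. *)
Definition overlap_of (k : 'I_n) (h : conf) : R := (tnth h k : R) * M h k.

Definition overlap (i : box 2 L) (w : T) : R :=
  eta (fsval i) w * gibbs_expectation V eps (eta ^~ w) (fun phi => height phi i).

Lemma overlapE i w : overlap i w = overlap_of (enum_rank i) (field_at w).
Proof.
rewrite /overlap /overlap_of tnth_mktuple /box_enum enum_rankK; congr (_ * _).
exact: (gibbs_expectation_height (@V_derivable) (@V_derivable2) V_second_derivative
  V_growth).
Qed.

Lemma measurable_overlap_of k : measurable_fun setT (overlap_of k).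
Proof.
apply: measurable_funM; first exact: measurable_tnth.
exact: (measurable_gibbs_mean (@V_derivable) (@V_derivable2) V_second_derivative
  V_growth).
Qed.

Lemma measurable_overlap i : measurable_fun setT (overlap i).
Proof.
rewrite (_ : overlap i = (fun w => overlap_of (enum_rank i) (field_at w))).
  by apply: (measurableT_comp (measurable_overlap_of _)); exact: measurable_sample.
by apply/funext => w; exact: overlapE.
Qed.

(** Monotonicity of the mean between [h] and its flip: they differ only at [k], by twice the field
    there. *)
Lemma overlap_of_flip k h : 0 <= overlap_of k h + overlap_of k (flip k h).
Proof.
have := gibbs_mean_monotone (@V_derivable) (@V_derivable2) V_second_derivative
  V_growth eps (flip k h) h.
rewrite (bigD1 k)//= big1 ?addr0; last first.
  by move=> j jk; rewrite tnth_mktuple (negbTE jk) subrr mul0r.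
rewrite /overlap_of tnth_mktuple eqxx opprK.
move: (M h k) (M (flip k h) k) => a b; move: (tnth h k : R) => t; lra.
Qed.

Lemma overlap_negative_part i : has_expectation P (overlap i) ->
  (\int[P]_w ((EFin \o overlap i)^\- w) < +oo)%E.
Proof.
rewrite (_ : overlap i = (fun w => overlap_of (enum_rank i) (field_at w))); last first.
  by apply/funext => w; exact: overlapE.
apply: (flip_negative_part eta_indep eta_sym (@box_enum_inj L)
  (measurable_overlap_of _)).
exact: overlap_of_flip.
Qed.

(** The kernel gain with the smaller box of half size, minus the pinning cost, which is linear in
    the number of sites. *)
Definition overlap_bound : R :=
  64^-1 * s2 * ((L./2).*2.+1 ^ 2)%:R * harm (L./2) - (L.*2.+1 ^ 2)%:R * lnC.

(* The minorant g is a polynomial of degree 2 in the fields, hence integrable. *)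
Lemma overlap_minorant : (1 < L)%N -> exists g v, [/\ has_integral P g v,
  overlap_bound <= v & forall w, g w <= \sum_(i : box 2 L) overlap i w].
Proof.
move=> L1.
have ML : (L./2 + L./2 <= L)%N by lia.
have M0 : (0 < L./2)%N by lia.
have [v hv bv] := kernel_quad eta_indep eta_id eta_sym eta_sq ML M0.
pose m (k : 'I_n) : R := @gibbs_mean R V L nng0 [tuple 0 : TR | i < n] k.
(* The zero-field means [m k] may be nonzero when [V] is not even; the linear term averages out
   because the fields are centred. *)
have h1 : has_integral P (fun w => \sum_(k < n) m k * eta (box_enum k) w) (\sum_(k <
  n) m k * 0).
  apply: has_integral_sum => k _; apply: has_integralZ.
  exact: (has_integral_X eta_indep eta_sym (@box_enum_inj L) eta_id eta_sq).
have h2 := has_integralD (has_integralD h1 hv) (has_integral_cst P (- ((L.*2.+1 ^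
  2)%:R * lnC))).
do 2 eexists; split; first exact: h2.
  by rewrite big1 ?add0r ?lerD2r// => k _; rewrite mulr0.
move=> w.
have := gibbs_mean_lower_bound (@V_derivable) (@V_derivable2) V_second_derivative
  V_growth eps
   (field_at w) (@kernel_mapZ R L (L./2) 32^-1).
have nE : n = (L.*2.+1 ^ 2)%N by rewrite -card_box cardfE.
rewrite [X in X%:R * lnC]nE => B.
have -> : \sum_(i : box 2 L) overlap i w = \sum_(k < n) (tnth (field_at w) k : R) *
  M (field_at w) k.
  rewrite (reindex (@enum_val (box 2 L) predT))/=; last first.
    by exists enum_rank => x _; [exact: enum_valK|exact: enum_rankK].
  by apply: eq_bigr => k _; rewrite overlapE /overlap_of enum_valK.
apply: le_trans B; rewrite lerD2r lerD2r le_eqVlt; apply/orP; left; apply/eqP.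
by apply: eq_bigr => k _; rewrite mulrC tnth_mktuple.
Qed.

Lemma expectation_sum_overlap_ge : (1 < L)%N ->
  (overlap_bound%:E <= 'E_P[fun w => (\sum_(i : box 2 L) overlap i w)%R])%E.
Proof.
move=> L1; have [g [v [gv bv gle]]] := overlap_minorant L1.
rewrite unlock; apply: (@le_trans _ _ v%:E); first by rewrite lee_fin.
apply: (integral_ge_has_integral gv _ gle).
by apply: measurable_sum => i; exact: measurable_overlap.
Qed.

Lemma sum_expectation_overlap_ge : (1 < L)%N ->
  (forall i, has_expectation P (overlap i)) ->
  (overlap_bound%:E <= \sum_(i : box 2 L) 'E_P[overlap i])%E.
Proof.
move=> L1 he; have [g [v [gv bv gle]]] := overlap_minorant L1.
rewrite (eq_bigr (fun i => \int[P]_w (overlap i w)%:E)%E); last first.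
  by move=> i _; rewrite unlock.
apply: (@le_trans _ _ v%:E); first by rewrite lee_fin.
apply: (sum_integral_ge_has_integral gv measurable_overlap gle) => i.
exact: overlap_negative_part.
Qed.

End overlap.

Lemma overlap_bound_asymptotic {R : realType} {d} {T : measurableType d}
  (P : probability T R) (eta : site 2 -> {RV P >->
    R}) (eps : {nonneg R}) (e : R) : 0 < e ->
  exists N : nat, forall L, (N <= L)%N -> [/\ (1 < L)%N, 0 < L%:R ^+ 2 * ln (L%:R : R) &
    64^-1 * second_moment eta 0 - e <= (L%:R ^+ 2 * ln L%:R)^-1 * overlap_bound eta
      eps L].
Proof.
move=> e0.
have half_le (L : nat) : (L <= (L./2).*2.+1)%N by lia.
have half_ge (L : nat) : (L <= (L./2).+1 * 2)%N by lia.
have double_le (L : nat) : (1 < L)%N -> (L.*2.+1 <= 3 * L)%N by lia.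
set s2 := second_moment eta 0.
have s20 : 0 <= s2 by exact: second_moment_ge0.
set lnC := ln (1 + eps%:num * expR (2 / 2)).
have lnC0 : 0 <= lnC by rewrite ln_ge0// lerDl mulr_ge0// expR_ge0.
have ln20 : 0 <= ln 2 :> R by rewrite ln_ge0//; lra.
(* [D] collects all errors of order [L^2]: the [ln 2] from halving the box, and the pinning cost
   with [(2 L + 1)^2 <= 9 L^2]. The number of sites in the half box causes no loss, as
   [L <= 2 (L / 2) + 1]. *)
pose D : R := 64^-1 * s2 * ln 2 + 9 * lnC.
exists (Num.truncn (expR (D / e))).+2 => L NL.
have L1 : (1 < L)%N by lia.
have Lr : expR (D / e) < L%:R :> R.
  by apply: (lt_le_trans (truncnS_gt _)); rewrite ler_nat; exact: leq_trans NL.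
have L0 : 0 < L%:R :> R by rewrite ltr0n; lia.
have lnL : D / e < ln L%:R :> R.
  by rewrite -[X in X < _]expRK ltr_ln ?posrE ?expR_gt0.
have lnL0 : 0 < ln L%:R :> R by rewrite ln_gt0// ltr1n.
have norm0 : 0 < L%:R ^+ 2 * ln L%:R :> R by rewrite mulr_gt0// exprn_gt0.
split => //; rewrite ler_pdivlMl//.
have DL : D <= e * ln L%:R by rewrite mulrC -ler_pdivrMr// ltW.
have A1 : L%:R ^+ 2 * (ln L%:R - ln 2) <= ((L./2).*2.+1 ^ 2)%:R * harm (L./2) :> R.
  apply: (@le_trans _ _ (L%:R ^+ 2 * harm (L./2))).
    rewrite ler_wpM2l ?exprn_ge0//.
    apply: le_trans (ln_le_harm _).
    rewrite -ln_div ?posrE// ler_ln ?posrE ?divr_gt0//.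
    by rewrite ler_pdivrMr// -natrM ler_nat.
  apply: ler_wpM2r; first exact: harm_ge0.
  by rewrite natrX lerXn2r ?nnegrE// ler_nat.
have A2 : (L.*2.+1 ^ 2)%:R <= 9 * L%:R ^+ 2 :> R.
  rewrite (_ : 9 * L%:R ^+ 2 = (3 * L%:R) ^+ 2); last by ring.
  by rewrite natrX lerXn2r ?nnegrE// -natrM ler_nat double_le.
have A3 := ler_wpM2r lnC0 A2.
have A4 := ler_wpM2l s20 A1.
have A5 := ler_wpM2l (exprn_ge0 2 (ltW L0)) DL.
rewrite /overlap_bound -/s2 -/lnC.
move: A3 A4 A5; rewrite /D; clear; clearbody s2 lnC.
move: (L%:R ^+ 2) (ln L%:R) (ln 2) (harm _) ((L.*2.+1 ^ 2)%:R) (((L./2).*2.+1 ^ 2)%:R).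
move=> a b c h i j; lra.
Qed.

Theorem theorem1p1 (R : realType) (V : R -> R)
  (V_derivable : forall t : R, derivable V t 1)
  (V_derivable2 : forall t : R, derivable (derive1 V) t 1)
  (V_second_derivative : forall t : R, derive1n 2 V t <= 1)
  (V_growth : (1 < limf_einf (fun t : R => (ln (V t) / ln `|t|)%:E)
                             (abs_pinfty R))%E) :
  exists a : R, 0 < a /\
    forall (d : measure_display) (T : measurableType d) (P : probability T R)
      (eta : site 2 -> {RV P >-> R}) (eps : {nonneg R}),
      mutually_independent eta ->
      identically_distributed eta ->
      (forall i, symmetrically_distributed (eta i)) ->
      ('E_P[fun w => (eta 0 w ^+ 2)%R] < +oo)%E ->
      let overlap (L : nat) (i : box 2 L) (w : T) : R :=
        eta (val i) w *
        gibbs_expectation V eps (eta ^~ w) (fun phi => height phi i) in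
      let norm (L : nat) : R := L%:R ^+ 2 * ln L%:R in
      ((forall (L : nat) (i : box 2 L), has_expectation P (overlap L i)) ->
       (a%:E * 'E_P[fun w => (eta 0 w ^+ 2)%R] <=
        limn_einf (fun L : nat =>
          ((norm L)^-1)%:E * \sum_(i : box 2 L) 'E_P[overlap L i]))%E) /\
      (a%:E * 'E_P[fun w => (eta 0 w ^+ 2)%R] <=
       limn_einf (fun L : nat =>
         ((norm L)^-1)%:E * 'E_P[fun w => (\sum_(i : box 2 L) overlap L i w)%R]))%E.
Proof.
exists 64^-1; split; first by rewrite invr_gt0.
move=> d T P eta eps eta_indep eta_id eta_sym eta_sq overlap_w norm.
have s2E : ('E_P[fun w => (eta 0%R w ^+ 2)%R] = (second_moment eta 0%R)%:E)%E.
  by rewrite /second_moment fineK// ge0_fin_numE// expectation_ge0// => w;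
    exact: sqr_ge0.
(* The sum of expectations and the expectation of the sum obey the same finite-volume bound, so the
   limit is taken once for both. *)
have key (u : nat -> \bar R) : (forall L, (1 < L)%N ->
  (overlap_bound eta eps L)%:E <= u L)%E ->
    ((64^-1)%:E * 'E_P[fun w => (eta 0%R w ^+ 2)%R] <=
      limn_einf (fun L : nat => ((norm L)^-1)%:E * u L))%E.
  move=> hu; rewrite s2E -EFinM; apply: limn_einf_ge => e e0.
  have [N hN] := overlap_bound_asymptotic eta eps e0.
  exists N => L NL; have [L1 n0 le_e] := hN L NL.
  apply: (@le_trans _ _ ((norm L)^-1%:E * (overlap_bound eta eps L)%:E)%E).
    by rewrite -EFinM lee_fin.
  by apply: lee_wpmul2l; [rewrite lee_fin invr_ge0 ltW|exact: hu].
split=> [he|].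
  apply: (key (fun L => \sum_(i : box 2 L) 'E_P[overlap_w L i])%E) => L L1.
  have h1 := sum_expectation_overlap_ge V_derivable V_derivable2 V_second_derivative
    V_growth eta_indep eta_id eta_sym eta_sq L1 (he L).
  exact: h1.
apply: (key (fun L => 'E_P[fun w => (\sum_(i : box 2 L) overlap_w L i w)%R])%E) => L L1.
exact: (expectation_sum_overlap_ge V_derivable V_derivable2 V_second_derivative
    V_growth eta_indep eta_id eta_sym eta_sq eps L1).
Qed.
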